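(* Let $g\in L^2(\mathbb{R})$ and $a,b>0$ be such that the Gabor system $\mathcal{G}(g,a,b)=\{E_b^mT_a^ng\}_{m,n\in\mathbb{Z}}$ is a frame of $L^2(\mathbb{R})$ and $ab\in\mathbb{R}\setminus\mathbb{Q}$. Then $\mathcal{G}(g,a,b)$, with any ordering over $\mathbb{Z}$, is not generated by an operator in $GL(L^2(\mathbb{R}))$; that is, for every bijection $\sigma:\mathbb{Z}\to\mathbb{Z}\times\mathbb{Z}$, writing $f_k:=E_b^{m}T_a^{n}g$ with $(m,n)=\sigma(k)$, there is no $T\in GL(L^2(\mathbb{R}))$ with $f_k=T^kf_0$ for all $k\in\mathbb{Z}$.
   Context: For $a,b\in\mathbb{R}$, the translation and modulation operators on $L^2(\mathbb{R})$ are $(T_af)(x)=f(x-a)$ and $(E_bf)(x)=e^{2\pi i bx}f(x)$. For a separable Hilbert space $\mathcal{H}$, $GL(\mathcal{H})$ is the set of bounded linear operators $T:\mathcal{H}\to\mathcal{H}$ that are bijective (hence with bounded inverse). A countable family $\{f_n\}_{n\in J}$ in $\mathcal{H}$ is a frame if there exist $A,B>0$ with $A\|f\|^2\le\sum_{n\in J}|\langle f,f_n\rangle|^2\le B\|f\|^2$ for all $f\in\mathcal{H}$. *)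

(* Defs.v *)
From HB Require Import structures.
From mathcomp Require Import all_boot all_order all_algebra.
From mathcomp Require Import generic_quotient ring_quotient complex.
From mathcomp Require Import all_classical all_reals all_analysis.
From mathcomp Require Import measurable_realfun ring.

Set Implicit Arguments.
Unset Strict Implicit.
Unset Printing Implicit Defensive.
Import Order.TTheory GRing.Theory Num.Theory.
Import numFieldTopology.Exports numFieldNormedType.Exports.
Import ComplexField.Normc.

Local Open Scope classical_set_scope.
Local Open Scope ring_scope.
Local Open Scope quotient_scope.

Section square_integrable.
Variable R : realType.
Local Notation mu := (@lebesgue_measure R).
Local Notation Re := (@complex.Re R).
Local Notation Im := (@complex.Im R).
Implicit Types (f g : R -> R[i]) (a b : R) (c d : R[i]).

Definition sqmod c : R := normc c ^+ 2.

Definition cmeasurable f :=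
  measurable_fun [set: R] (Re \o f) /\ measurable_fun [set: R] (Im \o f).

Definition sqintegrable f :=
  cmeasurable f /\ (\int[mu]_x (sqmod (f x))%:E < +oo)%E.

Definition sqint : {pred R -> R[i]} := fun f => `[< sqintegrable f >].

Lemma sqmodE c : sqmod c = Re c ^+ 2 + Im c ^+ 2.
Proof. by case: c => x y; rewrite /sqmod /= sqr_sqrtr// addr_ge0// sqr_ge0. Qed.

Lemma sqmod_ge0 c : 0 <= sqmod c.
Proof. exact: sqr_ge0. Qed.
#[local] Hint Resolve sqmod_ge0 : core.

Lemma sqmodM c d : sqmod (c * d) = sqmod c * sqmod d.
Proof. by rewrite /sqmod normcM exprMn. Qed.

Lemma sqmodD_le c d : sqmod (c + d) <= 2 * sqmod c + 2 * sqmod d.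
Proof.
rewrite !sqmodE -subr_ge0; case: c d => s t [u v] /=.
rewrite [leRHS](_ : _ = (s - u) ^+ 2 + (t - v) ^+ 2); last by ring.
by rewrite addr_ge0// sqr_ge0.
Qed.

Lemma measurable_sqmod f : cmeasurable f ->
  measurable_fun [set: R] (fun x => (sqmod (f x))%:E).
Proof.
move=> [mr mi]; apply/measurable_EFinP.
under eq_fun do rewrite sqmodE.
by apply: measurable_funD; exact: measurable_funX.
Qed.

Lemma cmeasurableD f g : cmeasurable f -> cmeasurable g -> cmeasurable (f + g).
Proof.
move=> [fr fi] [gr gi]; split.
- rewrite (_ : _ \o _ = (Re \o f) \+ (Re \o g)); first exact: measurable_funD.
  by apply/funext => x; rewrite /= !fctE; case: (f x) (g x) => ? ? [].
- rewrite (_ : _ \o _ = (Im \o f) \+ (Im \o g)); first exact: measurable_funD.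
  by apply/funext => x; rewrite /= !fctE; case: (f x) (g x) => ? ? [].
Qed.

Lemma cmeasurableM f g : cmeasurable f -> cmeasurable g ->
  cmeasurable (fun x => f x * g x).
Proof.
move=> [fr fi] [gr gi]; split.
- rewrite (_ : _ \o _ =
      (Re \o f) \* (Re \o g) \- (Im \o f) \* (Im \o g)).
    by apply: measurable_funB; exact: measurable_funM.
  by apply/funext => x /=; case: (f x) (g x) => ? ? [].
- rewrite (_ : _ \o _ =
      (Re \o f) \* (Im \o g) \+ (Im \o f) \* (Re \o g)).
    by apply: measurable_funD; exact: measurable_funM.
  by apply/funext => x /=; case: (f x) (g x) => ? ? [].
Qed.

Lemma sqint_submod_closed : submod_closed sqint.
Proof.
split.
  apply/asboolP; split.
    by split; rewrite (_ : _ \o _ = cst 0).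
  rewrite (_ : (fun x => _) = cst 0%E) ?integral0//.
  by apply/funext => x; rewrite sqmodE /= expr0n /= addr0.
move=> c f g /asboolP[mf foo] /asboolP[mg goo]; apply/asboolP.
have mcf : cmeasurable (c *: f).
  by apply: (@cmeasurableM (cst c)) => //; split; exact: measurable_cst.
split; first exact: cmeasurableD.
apply: (@le_lt_trans _ _ (\int[mu]_x
   ((2 * sqmod c)%:E * (sqmod (f x))%:E +
    2%:E * (sqmod (g x))%:E))%E); last first.
  have ? := measurable_sqmod mf; have ? := measurable_sqmod mg.
  rewrite ge0_integralD//; last 4 first.
  - by move=> x _; rewrite -EFinM lee_fin mulr_ge0// mulr_ge0//.
  - exact: measurable_funeM.
  - by move=> x _; rewrite -EFinM lee_fin mulr_ge0//.
  - exact: measurable_funeM.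
  rewrite !ge0_integralZl_EFin//; last 3 first.
  - by move=> x _; rewrite lee_fin.
  - by move=> x _; rewrite lee_fin.
  - by rewrite mulr_ge0//.
  by rewrite lte_add_pinfty// lte_mul_pinfty// lee_fin mulr_ge0//.
apply: ge0_le_integral => //.
- by move=> x _; rewrite lee_fin.
- exact: (measurable_sqmod (cmeasurableD mcf mg)).
- by apply: emeasurable_funD; apply: measurable_funeM; exact: measurable_sqmod.
move=> x _; rewrite -!EFinM -EFinD lee_fin -mulrA -sqmodM.
exact: sqmodD_le.
Qed.

HB.instance Definition _ :=
  GRing.isSubmodClosed.Build _ _ sqint sqint_submod_closed.

Record l2fun := L2Fun { l2fun_val :> R -> R[i]; _ : l2fun_val \in sqint }.
HB.instance Definition _ := [isSub of l2fun for l2fun_val].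
HB.instance Definition _ := [Choice of l2fun by <:].
HB.instance Definition _ := [SubChoice_isSubLmodule of l2fun by <:].

#[local] Instance ae_lebesgue_filter : Filter (nbhs (almost_everywhere mu)).
Proof. exact: (ae_filter_ringOfSetsType mu). Qed.

(* L2 is the space of classes of square integrable functions modulo equality
   almost everywhere, i.e. the quotient by the subspace l2null. *)
Definition l2null : {pred l2fun} :=
  fun f : l2fun => `[< {ae mu, forall x, f x = 0} >].

Lemma l2null_submod_closed : submod_closed l2null.
Proof.
split; first by apply/asboolP; exact: aeW.
move=> c f g /asboolP f0 /asboolP g0; apply/asboolP.
near=> x => /=.
have fx0 : f x = 0 by near: x.
have gx0 : g x = 0 by near: x.
by rewrite -[LHS]/(c * f x + g x) fx0 gx0 mulr0 addr0.
Unshelve. all: by end_near. Qed.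

HB.instance Definition _ :=
  GRing.isSubmodClosed.Build _ _ l2null l2null_submod_closed.

Definition L2 := Quotient.quot l2null.
HB.instance Definition _ := GRing.Zmodule.on L2.
HB.instance Definition _ := EqQuotient.on L2.

Lemma L2P (f g : l2fun) :
  reflect {ae mu, forall x, f x = g x} (f == g %[mod L2]).
Proof.
rewrite -Quotient.idealrBE; apply: (iffP (asboolP _)); apply: filterS => x /=.
- by move=> /eqP; rewrite subr_eq0 => /eqP.
- by move=> fg; rewrite -[LHS]/(f x - g x) fg subrr.
Qed.

Definition L2_scale c := lift_op1 L2 ( *:%R c : l2fun -> l2fun).

Lemma pi_L2_scale c : {morph \pi_L2 : f / c *: f >-> L2_scale c f}.
Proof.
move=> f; unlock L2_scale; apply/eqP/L2P.
have /eqP/L2P : repr (\pi_L2 f) = f %[mod L2] by rewrite reprK.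
by apply: filterS => x /= fE; rewrite -[LHS]/(c * f x) -fE.
Qed.
Canonical pi_L2_scale_morph c := PiMorph1 (pi_L2_scale c).

Let L2_scaleA c d (u : L2) : L2_scale c (L2_scale d u) = L2_scale (c * d) u.
Proof. by rewrite -[u]reprK !piE scalerA. Qed.

Let L2_scale1 : left_id 1 L2_scale.
Proof. by move=> u; rewrite -[u]reprK !piE scale1r. Qed.

Let L2_scaleDr : right_distributive L2_scale +%R.
Proof. by move=> c u v; rewrite -[u]reprK -[v]reprK !piE scalerDr. Qed.

Let L2_scaleDl (u : L2) : {morph L2_scale^~ u : c d / c + d}.
Proof. by move=> c d; rewrite -[u]reprK !piE scalerDl. Qed.

HB.instance Definition _ := GRing.Zmodule_isLmodule.Build R[i] L2
  L2_scaleA L2_scale1 L2_scaleDr L2_scaleDl.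


Lemma measurable_shift a :
  measurable_fun [set: measurableTypeR R]
    (fun x : R => x - a : measurableTypeR R).
Proof.
have : measurable_fun [set: R] (fun x : R => x - a) by apply: measurable_funB.
by [].
Qed.

Lemma lebesgue_measure_shift a (A : set R) : measurable A ->
  mu ((fun x => x - a) @^-1` A) = mu A.
Proof.
move=> mA; pose sh : measurableTypeR R -> measurableTypeR R := fun x => x - a.
pose nu : {measure set (measurableTypeR R) -> \bar R} := pushforward mu sh.
rewrite -[LHS]/(nu (measurable_shift a) A).
apply/esym/lebesgue_measure_unique => //.
move=> _ [[x y] _ <-] /=; rewrite /pushforward /=.
rewrite [X in _ = mu X](_ : _ = `]x + a, y + a]%classic).
  rewrite !lebesgue_measure_itv/= !lte_fin ltrD2r; case: ifP => // _.
  by rewrite -!EFinB; congr (_ %:E); ring.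
by apply/seteqP; split => z /=; rewrite !in_itv /= ltrBrDr lerBlDr.
Qed.

Lemma ge0_integral_shift a (h : R -> R) : measurable_fun [set: R] h ->
  (forall x, 0 <= h x) ->
  (\int[mu]_x (h (x - a))%:E = \int[mu]_x (h x)%:E)%E.
Proof.
move=> mh h0.
pose sh : measurableTypeR R -> measurableTypeR R := fun x => x - a.
have := @ge0_integral_pushforward _ _ _ _ R sh (measurable_shift a) mu setT
  (EFin \o h) measurableT.
rewrite preimage_setT /= => <-.
- apply: eq_measure_integral; first exact: measurable_shift.
  by move=> ? A mA _; exact: (lebesgue_measure_shift a mA).
- exact/measurable_EFinP.
- by move=> x _; rewrite lee_fin.
Qed.

Lemma ae_shift a (P : set R) :
  {ae mu, forall x, P x} -> {ae mu, forall x, P (x - a)}.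
Proof.
move=> [N [mN N0 sN]]; exists ((fun x => x - a) @^-1` N); split.
- rewrite -[X in measurable X]setTI.
  exact: (measurable_shift a measurableT mN).
- exact: etrans (lebesgue_measure_shift a mN) N0.
- by move=> x /= Px; apply: sN.
Qed.

Lemma sqint_translate a f : f \in sqint -> (fun x => f (x - a)) \in sqint.
Proof.
move=> /asboolP[[fr fi] fy]; apply/asboolP; split.
  by split; [exact: (measurableT_comp fr (measurable_shift a)) |
             exact: (measurableT_comp fi (measurable_shift a))].
have -> := @ge0_integral_shift a (sqmod \o f) _ (fun=> sqmod_ge0 _) => //.
by apply/measurable_EFinP; exact: (measurable_sqmod (conj fr fi)).
Qed.

Definition l2translate a (f : l2fun) : l2fun :=
  L2Fun (sqint_translate a (valP f)).

Definition translation a (u : L2) : L2 := \pi_L2 (l2translate a (repr u)).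

Lemma pi_translation a (f : l2fun) :
  translation a (\pi_L2 f) = \pi_L2 (l2translate a f).
Proof.
apply/eqP/L2P; have /eqP/L2P : repr (\pi_L2 f) = f %[mod L2] by rewrite reprK.
exact: (@ae_shift a (fun x => repr (\pi_L2 f) x = f x)).
Qed.

(* cis t = e^(it) *)
Definition cis (t : R) : R[i] := (cos t +i* sin t)%C.

Lemma sqmod_cis t : sqmod (cis t) = 1.
Proof. by rewrite sqmodE /= cos2Dsin2. Qed.

Lemma sqint_modulate b f : f \in sqint ->
  (fun x => cis (2 * pi * b * x) * f x) \in sqint.
Proof.
move=> /asboolP[mf fy]; apply/asboolP; split.
  apply: cmeasurableM => //; split => /=.
  - rewrite (_ : _ \o _ = cos \o ( *%R (2 * pi * b))); last by [].
    by apply: continuous_measurable_fun => x; apply: continuous_comp;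
      [exact: mulrl_continuous | exact: continuous_cos].
  - rewrite (_ : _ \o _ = sin \o ( *%R (2 * pi * b))); last by [].
    by apply: continuous_measurable_fun => x; apply: continuous_comp;
      [exact: mulrl_continuous | exact: continuous_sin].
by under eq_integral do rewrite sqmodM sqmod_cis mul1r.
Qed.

Definition l2modulate b (f : l2fun) : l2fun :=
  L2Fun (sqint_modulate b (valP f)).

Definition modulation b (u : L2) : L2 := \pi_L2 (l2modulate b (repr u)).

Lemma pi_modulation b (f : l2fun) :
  modulation b (\pi_L2 f) = \pi_L2 (l2modulate b f).
Proof.
apply/eqP/L2P; have /eqP/L2P : repr (\pi_L2 f) = f %[mod L2] by rewrite reprK.
by apply: filterS => x /= ->.
Qed.

Lemma translation_bij a : bijective (translation a).
Proof.
exists (translation (- a)) => u; rewrite -[u]reprK !pi_translation;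
  congr (\pi_L2 _); apply: val_inj; apply/funext => x /=; rewrite reprK;
  congr (l2fun_val _ _); ring.
Qed.

Lemma modulation_bij b : bijective (modulation b).
Proof.
have cisN t : cis t * cis (- t) = 1.
  rewrite /cis cosN sinN; apply/eqP; rewrite eq_complex /=; apply/andP.
  split; apply/eqP; last by ring.
  by rewrite mulrN opprK -!expr2 cos2Dsin2.
exists (modulation (- b)) => u; rewrite -[u]reprK !pi_modulation;
  congr (\pi_L2 _); apply: val_inj; apply/funext => x /=;
  rewrite reprK mulrA mulrN mulNr.
- by rewrite mulrC [_ * cis (2 * _ * _ * _)]mulrC cisN mulr1.
- by rewrite cisN mul1r.
Qed.

Definition cRintegral (h : R -> R[i]) : R[i] :=
  ((\int[mu]_x Re (h x)) +i* (\int[mu]_x Im (h x)))%C.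

(* linear in the first argument *)
Definition inner (u v : L2) : R[i] :=
  cRintegral (fun x => repr u x * ((repr v x)^*)%C).

Lemma inner_pi (f g : l2fun) :
  inner (\pi_L2 f) (\pi_L2 g) = cRintegral (fun x => f x * ((g x)^*)%C).
Proof.
have /eqP/L2P fE : repr (\pi_L2 f) = f %[mod L2] by rewrite reprK.
have /eqP/L2P gE : repr (\pi_L2 g) = g %[mod L2] by rewrite reprK.
have mprod (h k : l2fun) : cmeasurable (fun x => h x * ((k x)^*)%C).
  have /asboolP[mh _] := valP h; have /asboolP[[kr ki] _] := valP k.
  apply: cmeasurableM => //; split.
  - rewrite (_ : _ \o _ = Re \o k)//.
    by apply/funext => x /=; case: (k x).
  - rewrite (_ : _ \o _ = \- (Im \o k)); first exact: measurable_funN.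
    by apply/funext => x /=; case: (k x).
have [mr mi] := mprod (repr (\pi_L2 f)) (repr (\pi_L2 g)).
have [mr' mi'] := mprod f g.
rewrite /inner /cRintegral /Rintegral; congr (fine _ +i* fine _)%C;
  apply: ae_eq_integral => //; try exact/measurable_EFinP.
- by apply: filterS2 fE gE => x /= -> ->.
- by apply: filterS2 fE gE => x /= -> ->.
Qed.

Definition L2norm (u : L2) : R := Num.sqrt (Re (inner u u)).

Definition is_frame (J : countType) (f : J -> L2) := exists A B : R,
  [/\ 0 < A, 0 < B & forall h : L2,
    ((A * L2norm h ^+ 2)%:E <= \esum_(n in [set: J]) (sqmod (inner h (f n)))%:E
                           <= (B * L2norm h ^+ 2)%:E)%E].

Definition is_GL (T : L2 -> L2) : Prop :=
  [/\ linear T, exists M : R, forall u, L2norm (T u) <= M * L2norm u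
    & bijective T].

End square_integrable.

(* Integer powers of a bijective operator; for a bijection T, the library's
   partial inverse pinv is the two-sided inverse (lemma pinv_bijK). *)
Definition opz (V : zmodType) (T : V -> V) (k : int) : V -> V :=
  match k with
  | Posz n => iter n T
  | Negz n => iter n.+1 ('pinv_(fun=> 0) setT T)
  end.

Lemma pinv_bijK (V : zmodType) (T : V -> V) : bijective T ->
  cancel T ('pinv_(fun=> 0) setT T) /\ cancel ('pinv_(fun=> 0) setT T) T.
Proof.
move=> bT; have Tinj := bij_inj bT.
have TK : cancel T ('pinv_(fun=> 0) setT T).
  by move=> x; rewrite pinvKV ?inE//; move=> y z _ _; exact: Tinj.
split => // y; case: bT => S SK KS.
by rewrite -[in LHS](KS y) TK KS.
Qed.

Definition gabor (R : realType) (g : L2 R) (a b : R) (mn : int * int) : L2 R :=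
  opz (modulation b) mn.1 (opz (translation a) mn.2 g).

(* Main.v *)
Require Import Defs.
From mathcomp Require Import all_boot all_order all_algebra finmap.
From mathcomp Require Import generic_quotient complex.
From mathcomp Require Import all_classical all_reals all_analysis.
From mathcomp Require Import measurable_realfun ring lra zify.

(** Write [f w] for the Gabor function of index [w = (m, n)], and [U x] for the
    combination of the [f w] with finitely supported coefficients [x].  The
    proof shows that a bounded operator that runs through a Gabor frame along
    some enumeration of the index lattice forces the frame to be a Riesz basis,
    and that a Gabor Riesz basis has [a * b = 1], which is rational.

    The canonical dual frame is replaced by a quadratic form.  If [S] is the
    frame operator, then [< S^-1 h, h >] is the least squared norm of the
    coefficients that represent [h].  It is built here as [dual_energy], a
    supremum of regularised minima over finitely supported coefficients, so that
    neither the inverse of [S] nor any limit in L2 has to exist beforehand.  It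
    obeys the parallelogram inequality, hence comes from a form [dual_form]
    (Jordan and von Neumann), and the frame bounds make it equivalent to the
    squared norm ([energy_bound], [norm_le_dual_energy]).  A bounded operator
    that permutes the frame up to unimodular factors maps coefficients to
    coefficients of the same norm, so it cannot increase this energy
    ([dual_energy_map]).

    For [P := dual_form] this gives two kinds of invariance.  Time-frequency
    shifts preserve [P], so [|P (f u) (f v)|] depends on [u - v] only and all
    the [f w] have the same energy.  The operator [T] is a contraction for the
    energy that preserves the energy of each [f w], hence it preserves the
    products [P (f u) (f v)]: as [T] moves one step along the enumeration
    [sigma], [P (f (sigma k)) (f (sigma j))] depends on [k - j] only.  Suppose
    that such a product does not vanish for some [u != v].  By a Bessel
    inequality ([dual_form_bessel]) its modulus occurs for finitely many values
    of [k - j] only.  So the inverse of [sigma] moves by bounded steps along all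
    the lattice lines directed by [u - v], which is impossible: many parallel
    lines of a planar lattice do not fit side by side in the integers
    ([parallel_lines]).  Hence [P] is diagonal on the frame
    ([dual_form_diagonal]).

    When [P] is diagonal with diagonal value [c0], each [h] satisfies
    [c0 h = \sum_w P h (f w) f w] ([reconstruction]).  Test this on [h = v], the
    indicator of an interval of length [e <= 1 / b], and pair it with [v].  For a
    fixed translation [n], the sum over the modulations is a Fourier expansion
    on an interval of length [1 / b], and it equals [(1 / b) P (g 1_I) g] where
    [I] is a translate of the interval by a multiple of [a]
    ([interval_limit]).  Intervals that tile a period of length [a] give
    [c0 a = c0 / b] in total, that is [a * b = 1] ([lattice_density]).

    The expansion [fourier_expansion] rests on the density of the trigonometric
    polynomials in L2 of an interval.  The sets whose indicator is approximated
    by trigonometric polynomials with values in [[0, 1]] form a sigma-algebra,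
    and it contains the rays because of Bernoulli's inequality
    ([measurable_trig_approximable]). *)

Set Implicit Arguments.
Unset Strict Implicit.
Unset Printing Implicit Defensive.
Import Order.TTheory GRing.Theory Num.Theory.
Import numFieldTopology.Exports numFieldNormedType.Exports.
Import ComplexField.Normc.

Local Open Scope classical_set_scope.
Local Open Scope ring_scope.

Local Notation Re := (@complex.Re _).
Local Notation Im := (@complex.Im _).

(** * Real and imaginary parts *)

Section complex_numbers.
Variable R : realType.
Implicit Types (x y c d : R[i]) (r s : R).

Lemma ReD x y : Re (x + y) = Re x + Re y. Proof. by case: x y => ? ? []. Qed.
Lemma ImD x y : Im (x + y) = Im x + Im y. Proof. by case: x y => ? ? []. Qed.
Lemma ReN x : Re (- x) = - Re x. Proof. by case: x. Qed.
Lemma ImN x : Im (- x) = - Im x. Proof. by case: x. Qed.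
Lemma Re_mul x y : Re (x * y) = Re x * Re y - Im x * Im y.
Proof. by case: x y => ? ? []. Qed.
Lemma Im_mul x y : Im (x * y) = Re x * Im y + Im x * Re y.
Proof. by case: x y => ? ? []. Qed.
Lemma ReJ x : Re x^*%C = Re x. Proof. by case: x. Qed.
Lemma ImJ x : Im x^*%C = - Im x. Proof. by case: x. Qed.
Lemma ReR r : Re r%:C%C = r. Proof. by []. Qed.
Lemma ImR r : Im r%:C%C = 0. Proof. by []. Qed.

Lemma complex_eqP x y : Re x = Re y -> Im x = Im y -> x = y.
Proof. by case: x y => ? ? [? ?] /= -> ->. Qed.

Definition complex_parts := (ReD, ImD, ReN, ImN, Re_mul, Im_mul, ReJ, ImJ, ReR, ImR).

Lemma Re_sum I (r : seq I) (P : pred I) (F : I -> R[i]) :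
  Re (\sum_(i <- r | P i) F i) = \sum_(i <- r | P i) Re (F i).
Proof. by elim/big_rec2: _ => // i y z _ <-; rewrite ReD. Qed.

Lemma sqmodJ c : sqmod c^*%C = sqmod c.
Proof. by rewrite !sqmodE !complex_parts sqrrN. Qed.

Lemma sqmodN c : sqmod (- c) = sqmod c.
Proof. by rewrite !sqmodE !complex_parts !sqrrN. Qed.

Lemma sqmodR r : sqmod r%:C%C = r ^+ 2.
Proof. by rewrite sqmodE /= expr0n addr0. Qed.

Lemma sqmod0 : sqmod (0 : R[i]) = 0.
Proof. by rewrite sqmodE /= expr0n addr0. Qed.

Lemma mulcJ c : c * c^*%C = (sqmod c)%:C%C.
Proof. by apply: complex_eqP; rewrite !complex_parts ?sqmodE; ring. Qed.

Lemma sqmod_eq0 c : sqmod c = 0 -> c = 0.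
Proof.
rewrite sqmodE => /eqP; rewrite paddr_eq0 ?sqr_ge0// !sqrf_eq0.
by move=> /andP[/eqP ? /eqP ?]; exact: complex_eqP.
Qed.

(** Weighted arithmetic-geometric mean inequality: with a suitable weight it
    replaces the Cauchy-Schwarz inequality for finite sums. *)
Lemma Re_mul_le x y (s : R) : 0 < s ->
  2 * Re (x * y) <= s * sqmod x + sqmod y / s.
Proof.
move=> s0; rewrite Re_mul !sqmodE -subr_ge0.
rewrite [leRHS](_ : _ = (s * Re x - Re y) ^+ 2 / s + (s * Im x + Im y) ^+ 2 / s).
  by rewrite addr_ge0// divr_ge0 ?sqr_ge0// ltW.
by field; rewrite gt_eqF.
Qed.

Lemma Re_le_sqmod c r : 0 <= r -> sqmod c <= r ^+ 2 -> `|Re c| <= r.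
Proof.
move=> r0; rewrite sqmodE => h; rewrite -(ler_pXn2r (n := 2))// ?nnegrE//.
by rewrite real_normK ?num_real//; apply: le_trans h; rewrite lerDl sqr_ge0.
Qed.

End complex_numbers.

(** * Positive semidefinite hermitian forms *)

Section semi_inner_product.
Variables (R : realType) (V : lmodType R[i]).
Implicit Types (u v w : V) (c d : R[i]).

(** Semidefinite rather than definite, to serve the inner product of L2 as well
    as the form attached below to a frame. *)
Record semi_inner (phi : V -> V -> R[i]) : Prop := SemiInner {
  siDl : forall u v w, phi (u + v) w = phi u w + phi v w;
  siZl : forall c u v, phi (c *: u) v = c * phi u v;
  siC : forall u v, phi v u = (phi u v)^*%C;
  si_ge0 : forall u, 0 <= Re (phi u u) }.

Variables (phi : V -> V -> R[i]) (H : semi_inner phi).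
Definition sqn u : R := Re (phi u u).

Lemma sqn_ge0 u : 0 <= sqn u. Proof. exact: (si_ge0 H). Qed.

Lemma siDr u v w : phi u (v + w) = phi u v + phi u w.
Proof. by rewrite (siC H) (siDl H) rmorphD/= -!(siC H). Qed.

Lemma siZr c u v : phi u (c *: v) = c^*%C * phi u v.
Proof. by rewrite (siC H) (siZl H) rmorphM/= -(siC H). Qed.

Lemma si0l v : phi 0 v = 0.
Proof. by rewrite -(scale0r (0 : V)) (siZl H) mul0r. Qed.

Lemma si0r v : phi v 0 = 0.
Proof. by rewrite (siC H) si0l conjc0. Qed.

Lemma siNl u v : phi (- u) v = - phi u v.
Proof. by rewrite -scaleN1r (siZl H) mulN1r. Qed.

Lemma siNr u v : phi u (- v) = - phi u v.
Proof. by rewrite (siC H) siNl rmorphN/= -(siC H). Qed.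

Lemma siBl u v w : phi (u - v) w = phi u w - phi v w.
Proof. by rewrite (siDl H) siNl. Qed.

Lemma si_suml I (r : seq I) (P : pred I) (F : I -> V) v :
  phi (\sum_(i <- r | P i) F i) v = \sum_(i <- r | P i) phi (F i) v.
Proof.
by elim/big_rec2: _ => [|i y z _ <-]; rewrite ?si0l// (siDl H).
Qed.

Lemma si_sumr I (r : seq I) (P : pred I) (F : I -> V) v :
  phi v (\sum_(i <- r | P i) F i) = \sum_(i <- r | P i) phi v (F i).
Proof.
by elim/big_rec2: _ => [|i y z _ <-]; rewrite ?si0r// siDr.
Qed.

Lemma si_uu u : phi u u = (sqn u)%:C%C.
Proof.
apply: complex_eqP => //=; have := congr1 Im (siC H u u).
by rewrite ImJ; lra.
Qed.

Lemma sqnD u v : sqn (u + v) = sqn u + sqn v + 2 * Re (phi u v).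
Proof. by rewrite /sqn (siDl H) !siDr (siC H u v) !complex_parts; ring. Qed.

Lemma sqnN u : sqn (- u) = sqn u.
Proof. by rewrite /sqn siNl siNr opprK. Qed.

Lemma sqnB u v : sqn (u - v) = sqn u + sqn v - 2 * Re (phi u v).
Proof. by rewrite sqnD sqnN siNr !complex_parts mulrN. Qed.

Lemma sqnZ c u : sqn (c *: u) = sqmod c * sqn u.
Proof. by rewrite /sqn (siZl H) siZr mulrA mulcJ !complex_parts; ring. Qed.

Lemma sqn0 : sqn 0 = 0. Proof. by rewrite /sqn si0l. Qed.

Lemma sqn_parallelogram u v : sqn (u + v) + sqn (u - v) = 2 * sqn u + 2 * sqn v.
Proof. by rewrite sqnD sqnB; ring. Qed.

Lemma sqnD_le u v : sqn (u + v) <= 2 * sqn u + 2 * sqn v.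
Proof. by rewrite -sqn_parallelogram lerDl sqn_ge0. Qed.

Lemma cauchy_schwarz u v : sqmod (phi u v) <= sqn u * sqn v.
Proof.
set c := phi u v.
have key s : 0 <= sqn u - 2 * s * sqmod c + s ^+ 2 * sqmod c * sqn v.
  have := sqn_ge0 (u - (s%:C%C * c) *: v).
  rewrite sqnB sqnZ siZr -/c sqmodM sqmodR.
  suff -> : Re ((s%:C%C * c)^*%C * c) = s * sqmod c by lra.
  by rewrite sqmodE !complex_parts; ring.
have [v0|v0] := eqVneq (sqn v) 0.
  rewrite v0 mulr0 leNgt; apply/negP => c0.
  have := key ((sqn u + 1) / (2 * sqmod c)); rewrite v0 mulr0 addr0.
  suff -> : 2 * ((sqn u + 1) / (2 * sqmod c)) * sqmod c = sqn u + 1 by lra.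
  by field; rewrite gt_eqF.
have {}v0 : 0 < sqn v by rewrite lt_neqAle eq_sym v0 sqn_ge0.
have := key (sqn v)^-1.
rewrite -(ler_pM2r v0) mul0r => h; rewrite -subr_ge0; apply: (le_trans h).
by rewrite le_eqVlt; apply/orP; left; apply/eqP; field; rewrite gt_eqF.
Qed.

End semi_inner_product.

(** * From the parallelogram law to a hermitian form *)

Section jordan_von_neumann.
Variable R : realType.

(** The defect [D t - t * D 1] is additive and vanishes on the integers, so it is
    periodic and bounded; an additive bounded function vanishes. *)
Lemma additive_bounded_linear (D : R -> R) (M : R) :
  (forall s t, D (s + t) = D s + D t) ->
  (forall t, 0 <= t <= 1 -> `|D t| <= M) ->
  forall t, D t = t * D 1.
Proof.
move=> DD DM t.
have D0 : D 0 = 0 by have := DD 0 0; rewrite addr0; lra.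
have DN s : D (- s) = - D s by have := DD s (- s); rewrite subrr D0; lra.
have Dn n s : D (n%:R * s) = n%:R * D s.
  elim: n => [|n IH]; first by rewrite !mul0r.
  by rewrite -natr1 !mulrDl !mul1r DD IH.
have Dz (z : int) s : D (z%:~R * s) = z%:~R * D s.
  case: z => n; first exact: Dn.
  by rewrite NegzE mulrNz !mulNr DN Dn.
pose E s := D s - s * D 1.
suff : `|E t| <= 0 by rewrite normr_le0 subr_eq0 => /eqP.
pose K := M + `|D 1|.
have bound n : n%:R * `|E t| <= K.
  rewrite -[n%:R]ger0_norm// -normrM.
  have -> : n%:R * E t = E (n%:R * t - (Num.floor (n%:R * t))%:~R).
    rewrite /E DD DN Dn.
    have := Dz (Num.floor (n%:R * t)) 1; rewrite mulr1 => ->; ring.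
  set s := _ - _; have s01 : 0 <= s <= 1.
    have := Num.Theory.floor_itv (n%:R * t) => /andP[h1 h2].
    by apply/andP; split; rewrite /s; [rewrite subr_ge0|]; move: h2; rewrite intrD; lra.
  rewrite /E (le_trans (ler_normB _ _))// lerD ?DM// normrM.
  by case/andP: s01 => s0 s1; rewrite ger0_norm// ler_piMl.
rewrite leNgt; apply/negP => Et.
have := bound (Num.truncn (K / `|E t|)).+1.
have : K / `|E t| < (Num.truncn (K / `|E t|)).+1%:R by exact: truncnS_gt.
by rewrite ltr_pdivrMr// => /lt_le_trans h /h; rewrite ltxx.
Qed.

Variable V : lmodType R[i].
Variable Q : V -> R.
Hypothesis Q_ge0 : forall u, 0 <= Q u.
Hypothesis QZ : forall c u, Q (c *: u) = sqmod c * Q u.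
Hypothesis Qpar : forall u v, Q (u + v) + Q (u - v) <= 2 * Q u + 2 * Q v.
Implicit Types u v w : V.

Let pol u v : R := (Q (u + v) - Q (u - v)) / 4.
Definition polar u v : R[i] := (pol u v +i* pol u ('i%C *: v))%C.

Let sqmodi : sqmod ('i%C : R[i]) = 1.
Proof. by rewrite sqmodE /=; ring. Qed.

Let QN u : Q (- u) = Q u.
Proof. by rewrite -scaleN1r QZ sqmodE /=; ring. Qed.

Let Qpar_eq u v : Q (u + v) + Q (u - v) = 2 * Q u + 2 * Q v.
Proof.
apply/eqP; rewrite eq_le Qpar /=.
have := Qpar (u + v) (u - v).
have -> : u + v + (u - v) = (2 : R[i]) *: u.
  by rewrite addrACA subrr addr0 scaler_nat mulr2n.
have -> : u + v - (u - v) = (2 : R[i]) *: v.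
  by rewrite opprB [v - u]addrC addrACA subrr add0r scaler_nat mulr2n.
rewrite !QZ (_ : sqmod 2 = 4); first by lra.
by rewrite sqmodE/=; ring.
Qed.

Let polC u v : pol u v = pol v u.
Proof. by rewrite /pol (addrC u v) -(QN (u - v)) opprB. Qed.

Let polDl u v w : pol (u + v) w = pol u w + pol v w.
Proof.
have e1 := Qpar_eq (u + w) v; have e2 := Qpar_eq (u - w) v.
have e3 := Qpar_eq (v + w) u; have e4 := Qpar_eq (v - w) u.
have q1 : v + w - u = - (u - w - v) by rewrite !opprB addrA.
have q2 : v - w - u = - (u + w - v) by rewrite opprB opprD addrA addrAC.
rewrite q1 QN in e3; rewrite q2 QN in e4.
rewrite (addrAC u w) in e1; rewrite (addrAC u (- w)) in e2.
rewrite (addrAC v w) (addrC v u) in e3; rewrite (addrAC v (- w)) (addrC v u) in e4.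
by rewrite /pol; lra.
Qed.

Let pol_bound u v t : 0 <= t <= 1 -> `|pol (t%:C%C *: u) v| <= Q u + Q v.
Proof.
move=> /andP[t0 t1].
have := Qpar_eq (t%:C%C *: u) v; rewrite QZ sqmodR.
have := Q_ge0 (t%:C%C *: u + v); have := Q_ge0 (t%:C%C *: u - v).
have : t ^+ 2 * Q u <= Q u by rewrite ler_piMl// expr_le1.
have := Q_ge0 v; have := Q_ge0 u.
rewrite /pol; set x := Q (_ + _); set y := Q (_ - _) => *.
by rewrite ler_norml; apply/andP; split; lra.
Qed.

Let polZl t u v : pol (t%:C%C *: u) v = t * pol u v.
Proof.
have := @additive_bounded_linear (fun t => pol (t%:C%C *: u) v) (Q u + Q v).
move=> ->; last exact: pol_bound.
- by rewrite scale1r.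
- by move=> s r; rewrite rmorphD/= scalerDl polDl.
Qed.

Let pol_i u v : pol ('i%C *: u) ('i%C *: v) = pol u v.
Proof. by rewrite /pol -!scalerDr -scalerBr !QZ sqmodi !mul1r. Qed.

Let polNr u v : pol u (- v) = - pol u v.
Proof. by rewrite /pol opprK -mulNr opprB. Qed.

Let ii u : 'i%C *: ('i%C *: u) = - u.
Proof. by rewrite scalerA -expr2 sqr_i scaleN1r. Qed.

Let pol_il u v : pol ('i%C *: u) v = - pol u ('i%C *: v).
Proof. by rewrite -[in RHS]pol_i ii polNr opprK. Qed.

Let pol_uu u : pol u u = Q u.
Proof.
rewrite /pol subrr -mulr2n -scaler_nat QZ (_ : Q 0 = 0).
  by rewrite (_ : sqmod _ = 4); [field|rewrite sqmodE/=; ring].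
by rewrite -(scale0r (0 : V)) QZ sqmod0 mul0r.
Qed.

Lemma polarE u : polar u u = (Q u)%:C%C.
Proof.
apply: complex_eqP => /=; first exact: pol_uu.
have := pol_il u u; rewrite polC; lra.
Qed.

(** Additivity comes from four instances of the parallelogram law, real
    homogeneity from [additive_bounded_linear], since the parallelogram law also
    bounds the polar form on segments. *)
Lemma semi_inner_polar : semi_inner polar.
Proof.
split=> [u v w|c u v|u v|u].
- by apply: complex_eqP; rewrite !complex_parts; exact: polDl.
- have cu : c *: u =
      ((Re c)%:C%C : R[i]) *: u + ((Im c)%:C%C : R[i]) *: (('i%C : R[i]) *: u).
    by rewrite scalerA -scalerDl [in LHS](complexE c) mulrC.
  have Re_p (x y : V) : Re (polar x y) = pol x y by [].
  have Im_p (x y : V) : Im (polar x y) = pol x ('i%C *: y) by [].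
  apply: complex_eqP; rewrite !(complex_parts, Re_p, Im_p) cu polDl !polZl !pol_il ?ii ?polNr;
    ring.
- apply: complex_eqP; rewrite !complex_parts; first exact: polC.
  by rewrite -[LHS]/(pol v ('i%C *: u)) polC pol_il.
- by rewrite polarE; exact: Q_ge0.
Qed.

Lemma sqn_polar u : sqn polar u = Q u.
Proof. by rewrite /sqn polarE. Qed.

End jordan_von_neumann.

(** * Finite combinations of a family *)

Section finite_combinations.
Variables (R : realType) (V : lmodType R[i]) (J : choiceType) (f : J -> V).
Implicit Types (F G : {fset J}) (x y : J -> R[i]).

Definition synthesis F x : V := \sum_(j <- F) x j *: f j.
Definition coef_sqnorm F x : R := \sum_(j <- F) sqmod (x j).

Lemma coef_sqnorm_ge0 F x : 0 <= coef_sqnorm F x.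
Proof. by apply: sumr_ge0 => *; exact: sqmod_ge0. Qed.

Lemma synthesis_fset0 x : synthesis fset0 x = 0. Proof. by rewrite /synthesis big_seq_fset0. Qed.
Lemma coef_sqnorm_fset0 x : coef_sqnorm fset0 x = 0. Proof. by rewrite /coef_sqnorm big_seq_fset0. Qed.

Lemma synthesisZ c F x : synthesis F (fun j => c * x j) = c *: synthesis F x.
Proof. by rewrite /synthesis scaler_sumr; apply: eq_bigr => j _; rewrite scalerA. Qed.

Lemma coef_sqnormZ c F x : coef_sqnorm F (fun j => c * x j) = sqmod c * coef_sqnorm F x.
Proof. by rewrite /coef_sqnorm mulr_sumr; apply: eq_bigr => j _; rewrite sqmodM. Qed.

Lemma synthesisD F x y : synthesis F (fun j => x j + y j) = synthesis F x + synthesis F y.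
Proof. by rewrite /synthesis -big_split; apply: eq_bigr => j _; rewrite /= scalerDl. Qed.

Lemma synthesisB F x y : synthesis F (fun j => x j - y j) = synthesis F x - synthesis F y.
Proof.
by rewrite /synthesis -sumrN -big_split; apply: eq_bigr => j _; rewrite /= scalerBl.
Qed.

Lemma synthesis_extend F G x : (F `<=` G)%fset ->
  exists y, synthesis G y = synthesis F x /\ coef_sqnorm G y = coef_sqnorm F x.
Proof.
move=> FG; exists (fun j => if j \in F then x j else 0); split.
- rewrite /synthesis -(big_fset_incl _ FG)/=.
    by apply: eq_big_seq => j ->.
  by move=> j _ /negPf ->; rewrite scale0r.
- rewrite /coef_sqnorm -(big_fset_incl _ FG)/=.
    by apply: eq_big_seq => j ->.
  by move=> j _ /negPf ->; rewrite sqmod0.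
Qed.

(** Two finitely supported families of coefficients can be added once they are
    extended by zero to the union of their supports. *)
Lemma common_support F x F' x' : exists G y y',
  [/\ synthesis G y = synthesis F x, coef_sqnorm G y = coef_sqnorm F x, synthesis G y' = synthesis F' x'
    & coef_sqnorm G y' = coef_sqnorm F' x'].
Proof.
have [y [y1 y2]] := synthesis_extend x (fsubsetUl F F').
have [y' [y'1 y'2]] := synthesis_extend x' (fsubsetUr F F').
by exists (F `|` F')%fset, y, y'.
Qed.

Lemma coef_sqnorm_parallelogram F x y :
  coef_sqnorm F (fun j => x j + y j) + coef_sqnorm F (fun j => x j - y j) = 2 * coef_sqnorm F x + 2 * coef_sqnorm F y.
Proof.
rewrite /coef_sqnorm !mulr_sumr -!big_split; apply: eq_bigr => j _ /=.
by rewrite !sqmodE !complex_parts; ring.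
Qed.

Lemma coef_sqnormD_le F x y (s : R) : 0 < s ->
  coef_sqnorm F (fun j => x j + y j) <= (1 + s) * coef_sqnorm F x + (1 + s^-1) * coef_sqnorm F y.
Proof.
move=> s0; rewrite /coef_sqnorm !mulr_sumr -!big_split; apply: ler_sum => j _ /=.
have := Re_mul_le (x j) (y j)^*%C s0; rewrite sqmodJ !sqmodE !complex_parts; lra.
Qed.

End finite_combinations.

(** * The dual energy of a frame *)

Section frame_energy.
Variables (R : realType) (V : lmodType R[i]) (ip : V -> V -> R[i]).
Hypothesis H : semi_inner ip.
Variables (J : choiceType) (f : J -> V) (A B : R).
Hypotheses (A_gt0 : 0 < A) (AB : A <= B).
Hypothesis bessel : forall h (F : {fset J}),
  \sum_(j <- F) sqmod (ip h (f j)) <= B * sqn ip h.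
Hypothesis lower : forall h, exists F : {fset J},
  A * sqn ip h <= \sum_(j <- F) sqmod (ip h (f j)).
Implicit Types (h k u v w : V) (F G : {fset J}) (x y : J -> R[i]) (l : R).
Local Notation n := (sqn ip).
Local Notation synthesis := (synthesis f).
Let B_gt0 : 0 < B. Proof. exact: lt_le_trans AB. Qed.
Let n_ge0 u : 0 <= n u. Proof. exact: (sqn_ge0 H). Qed.

(** The synthesis operator is adjoint to the analysis operator, hence has the
    same bound. *)
Lemma synthesis_bound F x : n (synthesis F x) <= B * coef_sqnorm F x.
Proof.
set u := synthesis F x.
have e : n u = \sum_(j <- F) Re (x j * ip (f j) u).
  rewrite /sqn {1}/u /synthesis (si_suml H) Re_sum.
  by apply: eq_bigr => j _; rewrite (siZl H).
have : 2 * n u <= B * coef_sqnorm F x + n u.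
  rewrite e mulr_sumr; apply: (@le_trans _ _ (\sum_(j <- F)
    (B * sqmod (x j) + sqmod (ip u (f j)) / B))).
    by apply: ler_sum => j _; rewrite [ip u _](siC H) sqmodJ; exact: Re_mul_le.
  rewrite big_split /= -mulr_sumr lerD2l -mulr_suml -e.
  by rewrite ler_pdivrMr// mulrC; exact: bessel.
by lra.
Qed.

(** Tikhonov regularisation: for a frame operator [S] this is
    [< (S + 1 / l)^-1 h, h >].  It is finite for every [h] and exactly quadratic in
    [h], two properties that a minimum over exact representations of [h] would
    not have without completeness. *)
Definition energy l h : R :=
  inf [set s | exists F x, s = l * n (h - synthesis F x) + coef_sqnorm F x].

Let energy_has_lb l h : 0 <= l ->
  has_lbound [set s | exists F x, s = l * n (h - synthesis F x) + coef_sqnorm F x].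
Proof.
by move=> l0; exists 0 => _ [F [x ->]]; rewrite addr_ge0 ?coef_sqnorm_ge0// mulr_ge0.
Qed.

Let energy_n0 l h :
  [set s | exists F x, s = l * n (h - synthesis F x) + coef_sqnorm F x] !=set0.
Proof. by eexists; exists fset0, (fun=> 0). Qed.

Lemma energy_le l h F x : 0 <= l ->
  energy l h <= l * n (h - synthesis F x) + coef_sqnorm F x.
Proof. by move=> l0; apply: ge_inf; [exact: energy_has_lb|exists F, x]. Qed.

Lemma le_energy l h s :
  (forall F x, s <= l * n (h - synthesis F x) + coef_sqnorm F x) -> s <= energy l h.
Proof.
by move=> hs; apply: lb_le_inf; [exact: energy_n0|move=> _ [F [x ->]]].
Qed.

Lemma energy_approx l h eta : 0 < eta -> exists F x,
  l * n (h - synthesis F x) + coef_sqnorm F x < energy l h + eta.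
Proof.
move=> eta0; apply: contrapT => hn.
suff : energy l h + eta <= energy l h by lra.
apply: le_energy => F x; rewrite leNgt; apply/negP => hlt.
by apply: hn; exists F, x.
Qed.

Lemma energy_ge0 l h : 0 <= l -> 0 <= energy l h.
Proof.
by move=> l0; apply: le_energy => F x; rewrite addr_ge0 ?coef_sqnorm_ge0// mulr_ge0.
Qed.

Lemma energy_mono l l' h : 0 <= l -> l <= l' -> energy l h <= energy l' h.
Proof.
move=> l0 ll'; apply: le_energy => F x; apply: (le_trans (energy_le h F x l0)).
by rewrite lerD2r ler_wpM2r.
Qed.

Lemma energyZ_le l c h : 0 <= l -> energy l (c *: h) <= sqmod c * energy l h.
Proof.
move=> l0; have [c0|c0] := eqVneq (sqmod c) 0.
  rewrite c0 mul0r (sqmod_eq0 c0) scale0r.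
  apply: (le_trans (energy_le _ fset0 (fun=> 0) l0)).
  by rewrite synthesis_fset0 subrr coef_sqnorm_fset0 (sqn0 H) mulr0 addr0.
have {}c0 : 0 < sqmod c by rewrite lt_neqAle eq_sym c0 sqmod_ge0.
rewrite mulrC -ler_pdivrMr//; apply: le_energy => F x; rewrite ler_pdivrMr//.
apply: (le_trans (energy_le _ F (fun j => c * x j) l0)).
by rewrite synthesisZ coef_sqnormZ -scalerBr (sqnZ H); lra.
Qed.

Lemma energy_parallelogram l h k : 0 <= l ->
  energy l (h + k) + energy l (h - k) <= 2 * energy l h + 2 * energy l k.
Proof.
move=> l0; apply/ler_addgt0Pr => eta eta0.
have e4 : 0 < eta / 4 by rewrite divr_gt0.
have [F [x hx]] := energy_approx l h e4.
have [F' [x' hx']] := energy_approx l k e4.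
have [G [y [y' [s1 t1 s2 t2]]]] := common_support f F x F' x'.
have := energy_le (h + k) G (fun j => y j + y' j) l0.
have := energy_le (h - k) G (fun j => y j - y' j) l0.
have := coef_sqnorm_parallelogram G y y'.
rewrite synthesisB synthesisD s1 s2 t1 t2.
have -> : h + k - (synthesis F x + synthesis F' x') = h - synthesis F x + (k - synthesis F' x').
  by rewrite opprD addrACA.
have -> : h - k - (synthesis F x - synthesis F' x') = h - synthesis F x - (k - synthesis F' x').
  by rewrite !opprB addrACA [RHS]addrACA (addrC (- k)).
have := congr1 ( *%R l) (sqn_parallelogram H (h - synthesis F x) (k - synthesis F' x')).
lra.
Qed.

(** One step of gradient descent on [n (h - synthesis F x)], truncated to a finite
    set of indices that carries enough of the analysis coefficients of [h]. *)
Lemma landweber_step h : exists F x,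
  n (h - synthesis F x) <= (1 - A / B) * n h /\ coef_sqnorm F x <= n h / B.
Proof.
(* with the step size [1 / B] the quadratic term costs at most half of the
   first-order decrease *)
have [F hF] := lower h; pose x j := ((B^-1)%:C%C : R[i]) * ip h (f j).
exists F, x; set E := (X in _ <= X) in hF.
have eE : coef_sqnorm F x = E / B ^+ 2.
  by rewrite /x coef_sqnormZ sqmodR exprVn mulrC.
have EB : E <= B * n h := bessel h F.
split; last first.
  by rewrite eE expr2 invfM mulrA ler_pM2r ?invr_gt0// ler_pdivrMr// mulrC.
rewrite (sqnB H).
have -> : Re (ip h (synthesis F x)) = E / B.
  rewrite /synthesis (si_sumr H) Re_sum /E mulr_suml; apply: eq_bigr => j _.
  by rewrite (siZr H) sqmodE !complex_parts; ring.
have : n (synthesis F x) <= E / B.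
  apply: (le_trans (synthesis_bound F x)); rewrite eE expr2 invfM mulrCA mulrA.
  by rewrite -mulrA mulVKf// gt_eqF.
have : A / B * n h <= E / B by rewrite mulrAC ler_pM2r ?invr_gt0.
by lra.
Qed.

(** Writing [h] as the outcome of a descent step plus a smaller residual turns a
    bound [c] on the energy into the bound [a + (1 - d / 2) * c].  Starting from
    [c = l], given by the coefficients zero, iteration leads to a bound free of
    [l].  This is where the lower frame bound is used. *)
Lemma energy_bound : exists2 C : R, 0 <= C &
  forall l h, 0 < l -> energy l h <= C * n h.
Proof.
have := landweber_step; have : 0 < A / B by rewrite divr_gt0.
have : A / B <= 1 by rewrite ler_pdivrMr// mul1r.
move: (A / B) => d d1 d0 landweber.
pose a := (1 + 2 / d) / B.
have s0 : 0 < 2 / d by rewrite divr_gt0.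
have s1 : 0 < 1 + d / 2 by lra.
have sV : (2 / d)^-1 = d / 2 by rewrite invf_div.
have a0 : 0 <= a by apply: divr_ge0; [lra|exact: ltW].
have step l c : 0 < l -> 0 <= c -> (forall h, energy l h <= c * n h) ->
    forall h, energy l h <= (a + (1 - d / 2) * c) * n h.
  move=> l0 c0 hc h; have [F [x [hr hx]]] := landweber h.
  set r := h - synthesis F x in hr.
  suff : energy l h <= (1 + 2 / d) * (n h / B) + (1 + d / 2) * (c * ((1 - d) * n h)).
    move=> /le_trans; apply; rewrite /a -subr_ge0.
    rewrite [leRHS](_ : _ = d ^+ 2 / 2 * c * n h).
      apply: mulr_ge0 => //; apply: mulr_ge0 => //.
      by rewrite divr_ge0 ?sqr_ge0.
    by field; rewrite !gt_eqF.
  apply/ler_addgt0Pr => eta eta0.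
  have e4 : 0 < eta / (1 + d / 2) by rewrite divr_gt0.
  have [F' [x' hx']] := energy_approx l r e4.
  have [G [y [y' [q1 t1 q2 t2]]]] := common_support f F x F' x'.
  apply: (le_trans (energy_le h G (fun j => y j + y' j) (ltW l0))).
  rewrite synthesisD q1 q2 opprD addrA -/r.
  have := coef_sqnormD_le G y y' s0; rewrite t1 t2 sV => hD.
  have hx'' : l * n (r - synthesis F' x') + coef_sqnorm F' x' <= c * ((1 - d) * n h) + eta / (1 + d / 2).
    by apply: (le_trans (ltW hx')); rewrite lerD2r (le_trans (hc r))// ler_wpM2l.
  have := ler_wpM2l (ltW s1) hx''; rewrite !mulrDr [_ * (eta / _)]mulrC mulfVK ?gt_eqF//.
  have : (1 + 2 / d) * coef_sqnorm F x <= (1 + 2 / d) * (n h / B).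
    by rewrite ler_wpM2l// addr_ge0// ltW.
  have : l * n (r - synthesis F' x') <= (1 + d / 2) * (l * n (r - synthesis F' x')).
    by rewrite ler_peMl// ?mulr_ge0 ?(ltW l0)// lerDl divr_ge0// ltW.
  lra.
have K0 : 0 <= 2 * a / d by apply: divr_ge0; [exact: mulr_ge0|exact: ltW].
have iter l (k : nat) : 0 < l -> forall h,
    energy l h <= (2 * a / d + (1 - d / 2) ^+ k * l) * n h.
  move=> l0; elim: k => [h|k IH h].
    rewrite expr0 mul1r; apply: (le_trans (energy_le h fset0 (fun=> 0) (ltW l0))).
    by rewrite synthesis_fset0 subr0 coef_sqnorm_fset0 addr0 ler_wpM2r// lerDr.
  have q0 : 0 <= 1 - d / 2 by lra.
  have c0 : 0 <= 2 * a / d + (1 - d / 2) ^+ k * l.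
    by rewrite addr_ge0// mulr_ge0 ?exprn_ge0// ltW.
  have := step l _ l0 c0 IH h; congr (_ <= _ * _).
  by rewrite exprS; field; rewrite gt_eqF.
exists (2 * a / d) => //.
move=> l h l0; rewrite leNgt; apply/negP => hlt.
have lim : (fun k : nat => (1 - d / 2) ^+ k * (l * n h)) @ \oo --> (0 : R).
  rewrite -[X in _ --> X](mul0r (l * n h)); apply: cvgMl; apply: cvg_expr.
  by rewrite ger0_norm; lra.
have e0 : 0 < energy l h - 2 * a / d * n h by rewrite subr_gt0.
have /cvgrPdist_lt/(_ _ e0) [k _ hk] := lim.
have := hk k (leqnn k); rewrite /= sub0r normrN => /(le_lt_trans (ler_norm _)).
have := iter l k l0 h; rewrite mulrDl -mulrA; lra.
Qed.

(** The limit of [energy l h] as [l] grows, that is [< S^-1 h, h >]. *)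
Definition dual_energy h : R := sup [set s | exists2 l, 0 < l & s = energy l h].
Local Notation Q := dual_energy.

Lemma energy_le_dual l h : 0 < l -> energy l h <= Q h.
Proof.
move=> l0; have [C _ hC] := energy_bound; apply: ub_le_sup; last by exists l.
by exists (C * n h) => _ [m m0 ->]; exact: hC.
Qed.

Lemma dual_energy_le h s : (forall l, 0 < l -> energy l h <= s) -> Q h <= s.
Proof.
move=> hs; apply: ge_sup; first by exists (energy 1 h), 1.
by move=> _ [l l0 ->]; exact: hs.
Qed.

Lemma dual_energy_ge0 h : 0 <= Q h.
Proof. exact: le_trans (energy_ge0 h ler01) (energy_le_dual h ltr01). Qed.

Lemma dual_energy_bound : exists2 C : R, 0 <= C & forall h, Q h <= C * n h.
Proof.
have [C C0 hC] := energy_bound; exists C => // h.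
by apply: dual_energy_le => l l0; exact: hC.
Qed.

Lemma dual_energyZ c h : Q (c *: h) = sqmod c * Q h.
Proof.
have le d k : Q (d *: k) <= sqmod d * Q k.
  apply: dual_energy_le => l l0; apply: (le_trans (energyZ_le _ _ (ltW l0))).
  by rewrite ler_wpM2l ?sqmod_ge0// energy_le_dual.
apply/eqP; rewrite eq_le le /=; have [->|c0] := eqVneq c 0.
  by rewrite sqmod0 mul0r dual_energy_ge0.
have := le c^-1 (c *: h); rewrite scalerA mulVf// scale1r.
move=> /(ler_wpM2l (sqmod_ge0 c)); rewrite mulrA -sqmodM mulfV//.
by rewrite (_ : sqmod 1 = 1) ?mul1r// sqmodE /=; ring.
Qed.

Lemma dual_energy_parallelogram h k : Q (h + k) + Q (h - k) <= 2 * Q h + 2 * Q k.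
Proof.
suff main l l' : 0 < l -> 0 < l' ->
    energy l (h + k) + energy l' (h - k) <= 2 * Q h + 2 * Q k.
  rewrite -lerBrDr; apply: dual_energy_le => l l0.
  rewrite lerBrDr addrC -lerBrDr; apply: dual_energy_le => l' l'0.
  by rewrite lerBrDr addrC main.
(* both parameters can be raised to a common one *)
move=> l0 l'0; pose m := l + l'.
have m0 : 0 < m by rewrite addr_gt0.
have lm : l <= m by rewrite lerDl ltW.
have l'm : l' <= m by rewrite lerDr ltW.
have := energy_mono (h + k) (ltW l0) lm; have := energy_mono (h - k) (ltW l'0) l'm.
have := energy_parallelogram h k (ltW m0).
have := energy_le_dual h m0; have := energy_le_dual k m0; lra.
Qed.

Lemma dual_energy_synthesis F x : Q (synthesis F x) <= coef_sqnorm F x.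
Proof.
apply: dual_energy_le => l l0; apply: (le_trans (energy_le _ F x (ltW l0))).
by rewrite subrr (sqn0 H) mulr0 add0r.
Qed.

Lemma norm_le_dual_energy h : n h <= 2 * B * Q h.
Proof.
have Bi : 0 < B^-1 by rewrite invr_gt0.
have : n h / (2 * B) <= energy B^-1 h; last first.
  move=> /le_trans /(_ (energy_le_dual h Bi)).
  by rewrite ler_pdivrMr ?mulr_gt0// mulrC.
apply: le_energy => F x; rewrite ler_pdivrMr ?mulr_gt0//.
have := sqnD_le H (h - synthesis F x) (synthesis F x); rewrite subrK => /le_trans; apply.
have -> : (B^-1 * n (h - synthesis F x) + coef_sqnorm F x) * (2 * B) =
    2 * n (h - synthesis F x) + 2 * (B * coef_sqnorm F x).
  by field; rewrite gt_eqF.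
by have := synthesis_bound F x; lra.
Qed.

(** The energy stays bounded as [l] grows, so the residuals of near minimisers
    tend to zero. *)
Lemma dense_combinations h eta : 0 < eta -> exists F x, n (h - synthesis F x) <= eta.
Proof.
move=> eta0; have [C C0 hC] := energy_bound.
pose l := (C * n h + 1) / eta.
have p0 : 0 < C * n h + 1 by rewrite ltr_wpDl// mulr_ge0.
have l0 : 0 < l by rewrite divr_gt0.
have [F [x hx]] := energy_approx l h ltr01; exists F, x.
have : l * n (h - synthesis F x) <= C * n h + 1.
  have := hC l h l0; have := coef_sqnorm_ge0 F x; lra.
by rewrite /l mulrAC ler_pdivrMr// ler_pM2l.
Qed.

Definition dual_form : V -> V -> R[i] := polar Q.
Local Notation P := dual_form.

Lemma semi_inner_dual_form : semi_inner P.
Proof.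
apply: semi_inner_polar; [exact: dual_energy_ge0|exact: dual_energyZ|].
exact: dual_energy_parallelogram.
Qed.
Let HP := semi_inner_dual_form.

Lemma sqn_dual_form h : sqn P h = Q h.
Proof.
exact: sqn_polar dual_energyZ _.
Qed.

(** Expand the nonnegative energy of [h - \sum_j P h (f j) f j] and bound the
    energy of the sum by the squared norm of its coefficients. *)
Lemma dual_form_bessel h F : coef_sqnorm F (fun j => P h (f j)) <= Q h.
Proof.
set x := (fun j => P h (f j)).
have := sqn_ge0 HP (h - synthesis F x); rewrite (sqnB HP) !sqn_dual_form.
have -> : Re (P h (synthesis F x)) = coef_sqnorm F x.
  rewrite /synthesis (si_sumr HP) Re_sum; apply: eq_bigr => j _.
  by rewrite (siZr HP) -/(x j) sqmodE !complex_parts; ring.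
have := dual_energy_synthesis F x; lra.
Qed.

(** Coefficients for [h] are carried by [L] to coefficients for [L h] with the same
    norm, and the residual grows by a bounded factor only, which is absorbed by
    the regularisation parameter. *)
Lemma dual_energy_map (L : V -> V) (t t' : J -> J) (z : J -> R[i]) (M : R) :
  linear L -> 0 < M -> (forall h, n (L h) <= M * n h) -> cancel t t' ->
  (forall j, sqmod (z j) = 1) -> (forall j, L (f j) = z j *: f (t j)) ->
  forall h, Q (L h) <= Q h.
Proof.
move=> Llin M0 LM tK z1 Lf h.
have LD u v : L (u + v) = L u + L v by have := Llin 1 u v; rewrite !scale1r.
have L0 : L 0 = 0 by apply: (addrI (L 0)); rewrite -LD !addr0.
have LZ c u : L (c *: u) = c *: L u by have := Llin c u 0; rewrite !addr0 L0 addr0.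
apply: dual_energy_le => l l0; have lM : 0 < l * M by rewrite mulr_gt0.
apply: le_trans (energy_le_dual h lM); apply: le_energy => F x.
have tinj : {in F &, injective t} by move=> ? ? _ _; exact: (can_inj tK).
pose y (i : J) := z (t' i) * x (t' i).
have -> : coef_sqnorm F x = coef_sqnorm (t @` F)%fset y.
  rewrite /coef_sqnorm big_imfset//=; apply: eq_bigr => j _.
  by rewrite /y tK sqmodM z1 mul1r.
apply: (le_trans (energy_le _ (t @` F)%fset y (ltW l0))).
rewrite lerD2r -mulrA ler_wpM2l ?(ltW l0)//.
suff -> : synthesis (t @` F)%fset y = L (synthesis F x).
  by rewrite -scaleN1r -LZ scaleN1r -LD LM.
rewrite /synthesis big_imfset//= (big_morph L LD L0); apply: eq_bigr => j _.
by rewrite /y tK LZ Lf scalerA mulrC.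
Qed.

(** A contraction that preserves the length of [v] preserves the products with
    [v]: otherwise a small multiple of [w] added to [v] would contradict the
    contraction property to first order. *)
Lemma dual_form_contraction (L : V -> V) v w : linear L ->
  (forall h, Q (L h) <= Q h) -> Q (L v) = Q v -> P (L v) (L w) = P v w.
Proof.
move=> Llin LQ Lv; apply/eqP; rewrite -subr_eq0; apply/eqP/sqmod_eq0.
set d := P (L v) (L w) - P v w.
pose K := Q w; have K0 : 0 <= K := dual_energy_ge0 w.
(* small enough for the quadratic term to be dominated by the linear one *)
pose s := (K + 1)^-1; have s0 : 0 < s by rewrite invr_gt0; lra.
pose c : R[i] := s%:C%C * d.
have Lc : L (v + c *: w) = L v + c *: L w by rewrite addrC Llin addrC.
have := LQ (v + c *: w); rewrite Lc -!sqn_dual_form !(sqnD HP) !sqn_dual_form Lv.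
rewrite !dual_energyZ !(siZr HP).
have eP : P (L v) (L w) = d + P v w by rewrite /d subrK.
have -> : Re (c^*%C * P (L v) (L w)) = s * sqmod d + Re (c^*%C * P v w).
  by rewrite eP mulrDr ReD; congr (_ + _); rewrite /c sqmodE !complex_parts; ring.
have -> : sqmod c = s ^+ 2 * sqmod d by rewrite /c sqmodM sqmodR.
have q1 : 0 <= s ^+ 2 * sqmod d * Q (L w).
  by rewrite mulr_ge0 ?dual_energy_ge0// mulr_ge0 ?sqr_ge0 ?sqmod_ge0.
have q3 : 0 <= s * sqmod d by rewrite mulr_ge0 ?sqmod_ge0 ?(ltW s0).
have sK : s * K <= 1 by rewrite /s mulrC ler_pdivrMr ?mul1r; lra.
have q2 : s ^+ 2 * sqmod d * Q w <= s * sqmod d.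
  have := ler_wpM2l q3 sK; rewrite /K; lra.
move=> q4; have : s * sqmod d = 0 by lra.
by move=> /eqP; rewrite mulf_eq0 gt_eqF//= => /eqP.
Qed.

Section orthogonal.
Variable c0 : R.
Hypothesis orth : forall i j : J, i != j -> P (f i) (f j) = 0.
Hypothesis Qf : forall j, Q (f j) = c0.

(** The identity is exact on combinations of the family, because the family is
    orthogonal for the dual form; it extends by density, as both sides are
    uniformly bounded. *)
Lemma reconstruction h eta : 0 < eta -> exists F, forall G, (F `<=` G)%fset ->
  n (synthesis G (fun j => P h (f j)) - c0%:C%C *: h) <= eta.
Proof.
move=> eta0; have [C C0 hC] := dual_energy_bound.
pose K := 2 * (B * C + c0 ^+ 2).
have K0 : 0 <= K.
  by rewrite mulr_ge0// addr_ge0 ?sqr_ge0// mulr_ge0// ltW.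
have d0 : 0 < eta / (K + 1) by rewrite divr_gt0//; lra.
have [F [x hx]] := dense_combinations h d0; exists F => G FG.
set u := synthesis F x in hx *; set e := h - u in hx.
have Pu : synthesis G (fun j => P u (f j)) = c0%:C%C *: u.
  have [y [sy _]] := synthesis_extend f x FG; rewrite /u -sy.
  have Pj j : j \in G -> P (synthesis G y) (f j) = c0%:C%C * y j.
    move=> jG; rewrite /synthesis (si_suml HP).
    rewrite (bigD1_seq j) ?fset_uniq//= big1 ?addr0.
      by rewrite (siZl HP) (si_uu HP) sqn_dual_form Qf mulrC.
    by move=> i ij; rewrite (siZl HP) orth// mulr0.
  rewrite -synthesisZ /synthesis; apply: eq_big_seq => j jG.
  by rewrite Pj.
have eu : h = e + u by rewrite subrK.
have -> : synthesis G (fun j => P h (f j)) - c0%:C%C *: h =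
    synthesis G (fun j => P e (f j)) + (- c0%:C%C) *: e.
  have -> : synthesis G (fun j => P h (f j)) =
      synthesis G (fun j => P e (f j)) + c0%:C%C *: u.
    rewrite -Pu -synthesisD; apply: eq_bigr => j _; congr (_ *: _).
    by rewrite {1}eu (siDl HP).
  by rewrite eu scalerDr opprD addrACA subrr addr0 scaleNr.
apply: (le_trans (sqnD_le H _ _)); rewrite (sqnZ H) sqmodN sqmodR.
have h1 : n (synthesis G (fun j => P e (f j))) <= B * C * n e.
  apply: (le_trans (synthesis_bound _ _)); rewrite -mulrA ler_wpM2l ?(ltW B_gt0)//.
  exact: (le_trans (dual_form_bessel e G) (hC e)).
have h2 : K * n e <= eta.
  apply: (le_trans (ler_wpM2l K0 hx)).
  by rewrite mulrCA ler_piMr ?(ltW eta0)// ler_pdivrMr ?mul1r; lra.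
by rewrite /K in h2; lra.
Qed.

End orthogonal.
End frame_energy.

(** * Lines of the planar lattice in the integers *)

Section parallel_lines.

(** Take [2 M + 1] parallel lines directed by [w] and the first [N] points on each
    of them: their images are distinct integers whose absolute value is at most
    [C + M N], where [C] depends on the choice of the lines.  For [N] large the
    pigeonhole principle is violated. *)
Lemma parallel_lines (t : int * int -> int) (w : int * int) (M : nat) :
  injective t -> w != 0 -> (forall u, `|t (u + w) - t u| <= M%:Z) -> False.
Proof.
move=> tinj w0 step.
pose L := (M.*2).+1.
(* starting points on an axis that is transverse to [w] *)
pose base (i : nat) : int * int := if w.1 == 0 then (i%:Z, 0) else (0, i%:Z).
pose p (i n : nat) := base i + w *+ n.
have walk i n : `|t (p i n)| <= `|t (base i)| + (M * n)%:Z.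
  elim: n => [|n IH]; first by rewrite /p mulr0n addr0 muln0 addr0.
  have := step (p i n); rewrite {1}/p -addrA -mulrSr -/(p i n.+1) => h.
  have -> : t (p i n.+1) = t (p i n.+1) - t (p i n) + t (p i n) by rewrite subrK.
  rewrite mulnS PoszD addrCA; apply: (le_trans (ler_normD _ _)).
  exact: lerD.
have pinj i j n m : p i n = p j m -> i = j /\ n = m.
  case: w w0 @base @p {step walk} => w1 w2 w0 base p; rewrite /p /base /=.
  have pairMn k : (w1, w2) *+ k = (w1 *+ k, w2 *+ k).
    by elim: k => // k IH; rewrite !mulrS IH.
  have mulz_inj (x : int) (k l : nat) : x != 0 -> 0 + x *+ k = 0 + x *+ l -> k = l.
    move=> x0; rewrite !add0r -[x *+ k]mulr_natr -[x *+ l]mulr_natr.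
    by move=> /(mulfI x0); rewrite !natz => -[].
  rewrite !pairMn; have [w10|w10] := eqVneq w1 0.
    move=> h; have h1 : i%:Z + w1 *+ n = j%:Z + w1 *+ m := congr1 fst h.
    have h2 : 0 + w2 *+ n = 0 + w2 *+ m := congr1 snd h.
    have w20 : w2 != 0.
      by apply: contraNneq w0 => w20; rewrite w10 w20.
    split; first by move: h1; rewrite w10 !mul0rn; lia.
    exact: mulz_inj w20 h2.
  move=> h; have h1 : 0 + w1 *+ n = 0 + w1 *+ m := congr1 fst h.
  have h2 : i%:Z + w2 *+ n = j%:Z + w2 *+ m := congr1 snd h.
  have nm := mulz_inj _ _ _ w10 h1.
  by split => //; move: h2; rewrite nm => /addIr[].
pose C := \max_(i < L) `|t (base i)|%N.
pose N := (C.*2).+2; pose K := (C + M * N)%N.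
have tK (i : 'I_L) (n : 'I_N) : `|t (p i n)| <= K%:Z.
  apply: (le_trans (walk i n)); rewrite PoszD lerD//.
    by rewrite -abszE lez_nat; exact: (leq_bigmax i).
  by rewrite lez_nat leq_mul2l (ltnW (ltn_ord n)) orbT.
have fP (i : 'I_L) (n : 'I_N) : (absz (t (p i n) + K%:Z)%R < (K.*2).+1)%N.
  by have := tK i n; lia.
pose f (x : 'I_L * 'I_N) : 'I_(K.*2).+1 := Ordinal (fP x.1 x.2).
have finj : injective f.
  move=> [i n] [j m] /(congr1 val) /= h.
  have : t (p i n) = t (p j m) by have := tK i n; have := tK j m; lia.
  by move=> /tinj/pinj[/val_inj -> /val_inj ->].
have := leq_card f finj; rewrite card_prod !card_ord /K /L mulSn -doubleMl doubleD.
move: (M * N)%N => X; rewrite /N; lia.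
Qed.

End parallel_lines.

(** * Frames with lattice symmetry that are orbits of an operator *)

Section lattice_orbit.
Variables (R : realType) (V : lmodType R[i]) (ip : V -> V -> R[i]).
Hypothesis H : semi_inner ip.
Variables (f : int * int -> V) (A B : R).
Hypotheses (A_gt0 : 0 < A) (AB : A <= B).
Hypothesis bessel : forall h (F : {fset int * int}),
  \sum_(j <- F) sqmod (ip h (f j)) <= B * sqn ip h.
Hypothesis lower : forall h, exists F : {fset int * int},
  A * sqn ip h <= \sum_(j <- F) sqmod (ip h (f j)).
Local Notation Q := (dual_energy ip f).
Local Notation P := (dual_form ip f).
Let HP : semi_inner P := semi_inner_dual_form H A_gt0 AB bessel lower.

Variable L : int * int -> V -> V.
Hypothesis L_lin : forall w, linear (L w).
Hypothesis L_norm : forall w h, sqn ip (L w h) = sqn ip h.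
Hypothesis L_f : forall w, exists2 z : int * int -> R[i],
  forall v, sqmod (z v) = 1 & forall v, L w (f v) = z v *: f (v + w).

Lemma dual_energy_lattice w h : Q (L w h) <= Q h.
Proof.
have [z z1 Lf] := L_f w; apply: (dual_energy_map H A_gt0 AB bessel lower
  (t := fun v => v + w) (t' := fun v => v - w) (z := z) (M := 1)) => //.
- by move=> k; rewrite mul1r L_norm.
- by move=> v; rewrite addrK.
Qed.

Lemma dual_energy_orbit v : Q (f v) = Q (f 0).
Proof.
suff le u w : Q (f u) <= Q (f w) by apply/eqP; rewrite eq_le !le.
have [z z1 Lf] := L_f (u - w).
have := dual_energy_lattice (u - w) (f w); rewrite Lf addrC subrK.
by rewrite (dual_energyZ H A_gt0 AB bessel lower) z1 mul1r.
Qed.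

Let Q_L w v : Q (L w (f v)) = Q (f v).
Proof.
have [z z1 Lf] := L_f w.
by rewrite Lf (dual_energyZ H A_gt0 AB bessel lower) z1 mul1r !dual_energy_orbit.
Qed.

Lemma dual_form_lattice w v h : P (L w h) (L w (f v)) = P h (f v).
Proof.
rewrite (siC HP) (dual_form_contraction H A_gt0 AB bessel lower) -?(siC HP)//.
exact: dual_energy_lattice.
Qed.

Let sqmod_P_shift u v w : sqmod (P (f (u + w)) (f (v + w))) = sqmod (P (f u) (f v)).
Proof.
rewrite -(dual_form_lattice w v (f u)); have [z z1 Lf] := L_f w.
by rewrite !Lf (siZl HP) (siZr HP) !sqmodM sqmodJ !z1 !mul1r.
Qed.

Variables (s : int -> int * int) (T : V -> V) (M : R).
Hypotheses (s_bij : bijective s) (T_lin : linear T) (M_gt0 : 0 < M).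
Hypothesis T_norm : forall h, sqn ip (T h) <= M * sqn ip h.
Hypothesis T_f : forall k, T (f (s k)) = f (s (k + 1)).

Let P_toeplitz k j : P (f (s (k + j))) (f (s j)) = P (f (s k)) (f (s 0)).
Proof.
have [s' sK s'K] := s_bij.
have TQ : forall h, Q (T h) <= Q h.
  apply: (dual_energy_map H A_gt0 AB bessel lower (t := fun v => s (s' v + 1))
    (t' := fun v => s (s' v - 1)) (z := fun=> 1) (M := M)) => //.
  - by move=> v /=; rewrite sK addrK s'K.
  - by move=> v; rewrite sqmodE/= expr1n expr0n addr0.
  - by move=> v; rewrite scale1r -T_f s'K.
have step i l : P (f (s (i + 1))) (f (s (l + 1))) = P (f (s i)) (f (s l)).
  rewrite -!T_f; apply: (dual_form_contraction H A_gt0 AB bessel lower) => //.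
  by rewrite T_f !dual_energy_orbit.
have up i (m : nat) : P (f (s (i + m%:Z))) (f (s m%:Z)) = P (f (s i)) (f (s 0)).
  elim: m => [|m IH]; first by rewrite addr0.
  by rewrite -addn1 PoszD addrA step.
case: j => m; first exact: up.
have down (l : nat) i : P (f (s (i - l%:Z))) (f (s (- l%:Z))) = P (f (s i)) (f (s 0)).
  elim: l => [|l IH]; first by rewrite subr0.
  have e x : x - l.+1%:Z + 1 = x - l%:Z by lia.
  by rewrite -IH -[LHS]step e -[- l.+1%:Z]add0r e add0r.
by rewrite NegzE; exact: down.
Qed.

(** By the Bessel inequality a positive value is attained finitely often. *)
Let bounded_steps r : 0 < r -> exists K : nat, forall k,
  sqmod (P (f (s k)) (f (s 0))) = r -> `|k| <= K%:Z.
Proof.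
move=> r0; pose S := [set k | sqmod (P (f (s k)) (f (s 0))) = r].
have s_inj := bij_inj s_bij.
have finS : finite_set S.
  apply: contrapT => infS.
  have [F FS] := infinite_set_fset (Num.truncn (Q (f (s 0)) / r)).+1 infS.
  move=> Fn; have := dual_form_bessel H A_gt0 AB bessel lower (f (s 0)) (s @` F)%fset.
  rewrite /coef_sqnorm big_imfset/=; last by move=> ? ? _ _ /s_inj.
  rewrite (eq_big_seq (fun=> r)); last first.
    by move=> k kF; rewrite (siC HP) sqmodJ; exact: FS.
  rewrite big_const_seq count_predT iter_addr_0 -mulr_natr.
  apply/negP; rewrite -ltNge -ltr_pdivrMl// mulrC.
  apply: (lt_le_trans (truncnS_gt _)); by rewrite ler_nat.
have [F SF] := finite_fsetP.1 finS.
exists (\sum_(k <- F) `|k|%N)%N => k kS.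
have kF : k \in F by have : S k by []; rewrite SF.
by rewrite -abszE lez_nat (big_rem k)//= leq_addr.
Qed.

(** Lattice symmetry turns one nonzero product into nonzero products, of the same
    modulus, along all translates; seen through the enumeration [s] they join
    integers at bounded distance, against [parallel_lines]. *)
Lemma dual_form_diagonal i j : i != j -> P (f i) (f j) = 0.
Proof.
move=> ij; apply/sqmod_eq0/eqP; rewrite eq_sym eq_le sqmod_ge0/= leNgt.
apply/negP => r0; have [K hK] := bounded_steps r0.
have [s' sK s'K] := s_bij.
apply: (@parallel_lines s' (i - j) K); first exact: can_inj s'K.
  by rewrite subr_eq0.
move=> u; apply: hK; rewrite -(P_toeplitz _ (s' u)) subrK !s'K.
have e1 : i + (u - j) = u + (i - j) by rewrite addrCA.
have e2 : j + (u - j) = u by rewrite addrC subrK.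
by have := sqmod_P_shift i j (u - j); rewrite e1 e2.
Qed.

End lattice_orbit.

(** * The inner product of L2 *)

Section square_integrable_functions.
Variable R : realType.
Local Notation mu := (@lebesgue_measure R).
Local Notation l2fun := (l2fun R).
Local Notation L2 := (L2 R).
Implicit Types (f g h : l2fun) (u v w : L2) (c : R[i]).
Local Notation pi2 := (\pi_L2%qT : l2fun -> L2).

#[local] Instance ae_lebesgue_filter : Filter (nbhs (almost_everywhere mu)).
Proof. exact: (ae_filter_ringOfSetsType mu). Qed.

(** Reduces statements on classes to square integrable functions. *)
Lemma L2_ind (P : L2 -> Prop) : (forall f, P (pi2 f)) -> forall u, P u.
Proof. by move=> Pf u; rewrite -[u]reprK. Qed.

Lemma pi_L2D f g : pi2 (f + g) = pi2 f + pi2 g. Proof. by rewrite !piE. Qed.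
Lemma pi_L2Z c f : pi2 (c *: f) = c *: pi2 f. Proof. exact: pi_L2_scale. Qed.

Lemma l2_cmeasurable f : cmeasurable f.
Proof. by have /asboolP[] := valP f. Qed.

Lemma integrable_sqmod f : mu.-integrable [set: R] (EFin \o (fun x => sqmod (f x))).
Proof.
have /asboolP[mf fy] := valP f; apply/integrableP; split.
  exact: measurable_sqmod.
by under eq_integral do rewrite /= ger0_norm ?sqmod_ge0//.
Qed.

Lemma cmeasurableJ (k : R -> R[i]) : cmeasurable k -> cmeasurable (fun x => (k x)^*%C).
Proof.
move=> [kr ki]; split.
- by rewrite (_ : _ \o _ = Re \o k)//; apply/funext => x /=; rewrite ReJ.
- rewrite (_ : _ \o _ = \- (Im \o k)); first exact: measurable_funN.
  by apply/funext => x /=; rewrite ImJ.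
Qed.

Lemma integrable_product f g :
  mu.-integrable [set: R] (EFin \o (fun x => Re (f x * (g x)^*%C))) /\
  mu.-integrable [set: R] (EFin \o (fun x => Im (f x * (g x)^*%C))).
Proof.
have [mr mi] := cmeasurableM (l2_cmeasurable f) (cmeasurableJ (l2_cmeasurable g)).
have i2 : mu.-integrable [set: R] ((EFin \o (fun x => sqmod (f x))) \+
    (EFin \o (fun x => sqmod (g x)))).
  by apply: integrableD => //; exact: integrable_sqmod.
have bound (a b c d : R) : `|a * c + b * d| <= a ^+ 2 + b ^+ 2 + (c ^+ 2 + d ^+ 2).
  have := sqr_ge0 (a - c); have := sqr_ge0 (a + c).
  have := sqr_ge0 (b - d); have := sqr_ge0 (b + d).
  have := sqr_ge0 a; have := sqr_ge0 b; have := sqr_ge0 c; have := sqr_ge0 d.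
  by rewrite ler_norml => *; apply/andP; split; nra.
split; apply: (le_integrable measurableT _ _ i2).
- exact/measurable_EFinP.
- move=> x _ /=; rewrite lee_fin [leRHS]ger0_norm ?addr_ge0 ?sqmod_ge0//.
  by rewrite !sqmodE !complex_parts mulrN opprK bound.
- exact/measurable_EFinP.
- move=> x _ /=; rewrite lee_fin [leRHS]ger0_norm ?addr_ge0 ?sqmod_ge0//.
  rewrite !sqmodE !complex_parts mulrN addrC.
  by have := bound (Re (f x)) (Im (f x)) (- Im (g x)) (Re (g x)); rewrite sqrrN mulrN; lra.
Qed.

Lemma l2funD f g x : (f + g) x = f x + g x. Proof. by []. Qed.
Lemma l2funZ c f x : (c *: f) x = c * f x. Proof. by []. Qed.
Lemma Re_cRintegral (k : R -> R[i]) : Re (cRintegral k) = \int[mu]_x Re (k x).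
Proof. by []. Qed.
Lemma Im_cRintegral (k : R -> R[i]) : Im (cRintegral k) = \int[mu]_x Im (k x).
Proof. by []. Qed.

Lemma semi_inner_inner : semi_inner (@inner R).
Proof.
have iRe f g := (integrable_product f g).1.
have iIm f g := (integrable_product f g).2.
split.
- elim/L2_ind => f; elim/L2_ind => g; elim/L2_ind => h.
  rewrite -pi_L2D !inner_pi.
  apply: complex_eqP; rewrite !(complex_parts, Re_cRintegral, Im_cRintegral) -RintegralD//;
    by apply: eq_Rintegral => x _; rewrite l2funD mulrDl !complex_parts.
- move=> c; elim/L2_ind => f; elim/L2_ind => g.
  rewrite -pi_L2Z !inner_pi.
  have mZ r (k : R -> R) : mu.-integrable [set: R] (EFin \o k) ->
      mu.-integrable [set: R] (EFin \o (fun x => r * k x)).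
    by move=> ik; exact: (integrableZl measurableT r ik).
  apply: complex_eqP; rewrite !(complex_parts, Re_cRintegral, Im_cRintegral) -!RintegralZl//.
    rewrite -RintegralB; try by [exact: mZ|].
    by apply: eq_Rintegral => x _; rewrite l2funZ -mulrA !complex_parts.
  rewrite -RintegralD; try by [exact: mZ|].
  by apply: eq_Rintegral => x _; rewrite l2funZ -mulrA !complex_parts.
- elim/L2_ind => f; elim/L2_ind => g; rewrite !inner_pi.
  apply: complex_eqP; rewrite !(complex_parts, Re_cRintegral, Im_cRintegral).
    by apply: eq_Rintegral => x _; rewrite !complex_parts; ring.
  rewrite -mulN1r -RintegralZl//; apply: eq_Rintegral => x _; rewrite !complex_parts; ring.
- elim/L2_ind => f; rewrite inner_pi Re_cRintegral; apply: Rintegral_ge0 => x _.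
  by rewrite mulcJ ReR sqmod_ge0.
Qed.

Local Notation n2 := (sqn (@inner R)).

Lemma sqn_pi f : n2 (pi2 f) = \int[mu]_x sqmod (f x).
Proof.
rewrite /sqn inner_pi Re_cRintegral; apply: eq_Rintegral => x _.
by rewrite mulcJ ReR.
Qed.

Lemma L2norm_sqr u : L2norm u ^+ 2 = n2 u.
Proof. by rewrite /L2norm sqr_sqrtr//; exact: (si_ge0 semi_inner_inner). Qed.

Lemma le_sqn_pi f g : (forall x, sqmod (f x) <= sqmod (g x)) ->
  n2 (pi2 f) <= n2 (pi2 g).
Proof. by move=> fg; rewrite !sqn_pi; apply: le_Rintegral => //; exact: integrable_sqmod. Qed.

Lemma sqn_dominated (f_ : nat -> l2fun) g :
  (forall n x, sqmod (f_ n x) <= sqmod (g x)) ->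
  {ae mu, forall x, (fun n => sqmod (f_ n x)) @ \oo --> (0 : R)} ->
  forall eta, 0 < eta -> exists N : nat, forall n, (N <= n)%N ->
    n2 (pi2 (f_ n)) <= eta.
Proof.
move=> fg f0 eta eta0.
have [|||_ _ h] := @dominated_convergence _ _ _ mu setT measurableT
  (fun n => EFin \o (fun x => sqmod (f_ n x))) (cst 0%E)
  (EFin \o (fun x => sqmod (g x))) _ (measurable_cst _) _ (integrable_sqmod g).
- by move=> n; exact: (measurable_sqmod (l2_cmeasurable _)).
- apply: filterS f0 => x h _.
  exact: (@cvg_comp _ _ _ _ EFin _ _ _ h).
- apply: aeW => x n _ /=.
  by rewrite lee_fin ger0_norm ?sqmod_ge0.
rewrite integral0 in h.
have : (fun n => n2 (pi2 (f_ n))) @ \oo --> (0 : R).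
  by under eq_fun do rewrite sqn_pi; exact: (fine_cvg h).
move=> /cvgrPdist_le/(_ _ eta0)[N _ hN]; exists N => n Nn.
by have := hN n Nn; rewrite sub0r normrN => /(le_trans (ler_norm _)).
Qed.

End square_integrable_functions.

(** * Translations, modulations and restrictions *)

Section linear_operators.
Variables (R : realType) (V : lmodType R[i]).
Variables (L : V -> V) (L_lin : linear L).

Lemma lin0 : L 0 = 0.
Proof.
apply: (addrI (L 0)); have := L_lin 1 0 0.
by rewrite scale1r addr0 scale1r addr0 => <-.
Qed.
Lemma linD u v : L (u + v) = L u + L v.
Proof. by have := L_lin 1 u v; rewrite !scale1r. Qed.
Lemma linZ c u : L (c *: u) = c *: L u.
Proof. by have := L_lin c u 0; rewrite lin0 !addr0. Qed.
Lemma linB u v : L (u - v) = L u - L v.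
Proof. by rewrite linD -scaleN1r linZ scaleN1r. Qed.
Lemma lin_sum I (r : seq I) (P : pred I) (F : I -> V) :
  L (\sum_(i <- r | P i) F i) = \sum_(i <- r | P i) L (F i).
Proof. exact: (big_morph L linD lin0). Qed.

(** Polarisation. *)
Lemma isometry_inner (phi : V -> V -> R[i]) : semi_inner phi ->
  (forall u, sqn phi (L u) = sqn phi u) -> forall u v, phi (L u) (L v) = phi u v.
Proof.
move=> H iso u v.
have key w : Re (phi (L u) (L w)) = Re (phi u w).
  by have := iso (u + w); rewrite linD !(sqnD H) !iso; lra.
have [j [j0 j1]] : exists j : R[i], Re j = 0 /\ Im j = 1.
  by exists (0 +i* 1)%C.
apply: complex_eqP => //; have := key (j *: v).
by rewrite linZ !(siZr H) !complex_parts j0 j1; lra.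
Qed.

End linear_operators.

Section time_frequency.
Variable R : realType.
Local Notation mu := (@lebesgue_measure R).
Local Notation l2fun := (l2fun R).
Local Notation L2 := (L2 R).
Local Notation n2 := (sqn (@inner R)).
Local Notation pi2 := (\pi_L2%qT : l2fun -> L2).
Implicit Types (f g h : l2fun) (u v w : L2) (c : R[i]) (s t : R).

Lemma cisD s t : cis (s + t) = cis s * cis t.
Proof. by apply: complex_eqP; rewrite !complex_parts /= ?cosD ?sinD//; ring. Qed.
Lemma cis0 : cis (0 : R) = 1.
Proof. by apply: complex_eqP; rewrite /= ?cos0 ?sin0. Qed.
Lemma cisJ s : (cis s)^*%C = cis (- s).
Proof. by apply: complex_eqP; rewrite !complex_parts /= ?cosN ?sinN. Qed.

Lemma translation_linear s : linear (translation s : L2 -> L2).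
Proof.
move=> c; elim/L2_ind => f; elim/L2_ind => g.
by rewrite -pi_L2Z -pi_L2D !pi_translation -pi_L2Z -pi_L2D; congr (pi2 _); apply: val_inj.
Qed.

Lemma modulation_linear s : linear (modulation s : L2 -> L2).
Proof.
move=> c; elim/L2_ind => f; elim/L2_ind => g.
rewrite -pi_L2Z -pi_L2D !pi_modulation -pi_L2Z -pi_L2D; congr (pi2 _).
apply: val_inj; apply/funext => x /=.
by rewrite -[LHS]/(_ * (c * f x + g x)) mulrDr mulrCA.
Qed.

Lemma translation_norm s u : n2 (translation s u) = n2 u.
Proof.
elim/L2_ind: u => f; rewrite pi_translation !sqn_pi /Rintegral /=.
rewrite (@ge0_integral_shift _ s (fun x => sqmod (f x)))//.
  apply/measurable_EFinP; exact: (measurable_sqmod (l2_cmeasurable f)).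
by move=> x; exact: sqmod_ge0.
Qed.

Lemma modulation_norm s u : n2 (modulation s u) = n2 u.
Proof.
elim/L2_ind: u => f; rewrite pi_modulation !sqn_pi.
by apply: eq_Rintegral => x _; rewrite /= sqmodM sqmod_cis mul1r.
Qed.

Lemma translationD s t u : translation s (translation t u) = translation (s + t) u.
Proof.
elim/L2_ind: u => f; rewrite !pi_translation; congr (pi2 _); apply: val_inj.
by apply/funext => x /=; rewrite opprD addrA.
Qed.

Lemma translation0 u : translation 0 u = u.
Proof.
elim/L2_ind: u => f; rewrite !pi_translation; congr (pi2 _); apply: val_inj.
by apply/funext => x /=; rewrite subr0.
Qed.

Lemma modulationD s t u : modulation s (modulation t u) = modulation (s + t) u.
Proof.
elim/L2_ind: u => f; rewrite !pi_modulation; congr (pi2 _); apply: val_inj.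
by apply/funext => x; rewrite /= mulrA -cisD; congr (cis _ * _); ring.
Qed.

Lemma modulation0 u : modulation 0 u = u.
Proof.
elim/L2_ind: u => f; rewrite !pi_modulation; congr (pi2 _); apply: val_inj.
by apply/funext => x /=; rewrite mulr0 mul0r cis0 mul1r.
Qed.

Lemma translation_modulation s t u :
  translation s (modulation t u) = cis (- (2 * pi * t * s)) *: modulation t (translation s u).
Proof.
elim/L2_ind: u => f; rewrite !(pi_translation, pi_modulation) -pi_L2Z.
congr (pi2 _); apply: val_inj; apply/funext => x.
rewrite -[RHS]/(cis _ * (cis _ * f (x - s))) /= mulrA -cisD.
congr (cis _ * _); ring.
Qed.

Let opz_group (T : R -> L2 -> L2) :
  (forall s t u, T s (T t u) = T (s + t) u) -> (forall u, T 0 u = u) ->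
  forall s k u, opz (T s) k u = T (k%:~R * s) u.
Proof.
move=> TD T0 s k u.
have Tb : bijective (T s).
  by exists (T (- s)) => v; rewrite TD ?addNr ?subrr T0.
have [TK KT] := pinv_bijK Tb.
case: k => n.
  elim: n => [|n IH] /=; first by rewrite mul0r T0.
  by rewrite -[iter n _ _]/(opz (T s) n u) IH TD -addn1 PoszD intrD mulrDl mul1r addrC.
have pinvE v : 'pinv_(fun=> 0) setT (T s) v = T (- s) v.
  by rewrite -[in RHS](KT v) TD addNr T0.
suff {n} neg n : iter n.+1 ('pinv_(fun=> 0) setT (T s)) u = T (- n.+1%:R * s) u.
  exact: neg.
elim: n => [|n IH]; first by rewrite /= pinvE mulN1r.
by rewrite iterS IH pinvE TD -[in RHS]natr1 opprD mulrDl mulN1r addrC.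
Qed.

(** Translations and modulations are one-parameter groups, so their integer powers
    are again translations and modulations. *)
Lemma gaborE (g : L2) (a b : R) (w : int * int) :
  gabor g a b w = modulation (w.1%:~R * b) (translation (w.2%:~R * a) g).
Proof.
rewrite /gabor (opz_group modulationD modulation0).
by rewrite (opz_group translationD translation0).
Qed.

Section restriction.
Variables (A : set R) (mA : measurable A).

Let cmeasurable_indic : cmeasurable (fun x => (\1_A x)%:C%C : R[i]).
Proof.
split; first by rewrite (_ : _ \o _ = \1_A)//; exact: measurable_indic.
by rewrite (_ : _ \o _ = cst 0)//; exact: measurable_cst.
Qed.

Lemma sqint_cut f : (fun x => (\1_A x)%:C%C * f x) \in @sqint R.
Proof.
apply/asboolP; split; first exact: cmeasurableM (l2_cmeasurable f).
have /asboolP[mf] := valP f; apply: le_lt_trans; apply: ge0_le_integral => //.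
- by move=> x _; rewrite lee_fin sqmod_ge0.
- by apply: measurable_sqmod; exact: cmeasurableM (l2_cmeasurable f).
- exact: measurable_sqmod.
- move=> x _; rewrite lee_fin sqmodM sqmodR indicE.
  by case: (_ \in _); rewrite ?expr1n ?expr0n ?mul1r ?mul0r// sqmod_ge0.
Qed.

Definition l2cut f : l2fun := L2Fun (sqint_cut f).
Definition cut u : L2 := pi2 (l2cut (repr u)).

Lemma pi_cut f : cut (pi2 f) = pi2 (l2cut f).
Proof.
apply/eqP/L2P; have /eqP/L2P : repr (pi2 f) = f %[mod L2]%qT by rewrite reprK.
have FF : Filter (nbhs (almost_everywhere mu)) := ae_filter_ringOfSetsType mu.
by apply: filterS => x /= ->.
Qed.

Lemma cut_linear : linear cut.
Proof.
move=> c; elim/L2_ind => f; elim/L2_ind => g.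
rewrite -pi_L2Z -pi_L2D !pi_cut -pi_L2Z -pi_L2D; congr (pi2 _).
apply: val_inj; apply/funext => x /=.
by rewrite -[LHS]/(_ * (c * f x + g x)) mulrDr mulrCA.
Qed.

Lemma cut_norm u : n2 (cut u) <= n2 u.
Proof.
elim/L2_ind: u => f; rewrite pi_cut; apply: le_sqn_pi => x /=.
rewrite sqmodM sqmodR indicE.
by case: (_ \in _); rewrite ?expr1n ?expr0n ?mul1r ?mul0r// sqmod_ge0.
Qed.

Lemma cut_self_adjoint u v : inner (cut u) v = inner u (cut v).
Proof.
elim/L2_ind: u => f; elim/L2_ind: v => g; rewrite !pi_cut !inner_pi.
rewrite /cRintegral; congr (_ +i* _)%C; apply: eq_Rintegral => x _;
  rewrite /= !complex_parts; ring.
Qed.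

Lemma cut_modulation s u : cut (modulation s u) = modulation s (cut u).
Proof.
elim/L2_ind: u => f; rewrite !(pi_cut, pi_modulation).
by congr (pi2 _); apply: val_inj; apply/funext => x; rewrite /= mulrCA.
Qed.

Hypothesis A_fin : (mu A < +oo)%E.

Lemma sqint_indic : (fun x => (\1_A x)%:C%C) \in @sqint R.
Proof.
apply/asboolP; split => //.
have -> : (fun x => (sqmod ((\1_A x)%:C%C : R[i]))%:E) = (EFin \o \1_A : R -> \bar R).
  apply/funext => x; rewrite sqmodR /= indicE.
  by case: (_ \in _); rewrite ?expr1n ?expr0n.
by rewrite integral_indic// setIT.
Qed.

Definition l2indic : l2fun := L2Fun sqint_indic.
Definition indicL2 : L2 := pi2 l2indic.

Lemma indicL2_norm : n2 indicL2 = fine (mu A).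
Proof.
rewrite sqn_pi /Rintegral -[in RHS](setIT A) -integral_indic//; congr fine.
apply: eq_integral => x _ /=; rewrite sqmodR indicE.
by case: (_ \in _); rewrite ?expr1n ?expr0n.
Qed.

End restriction.
End time_frequency.

(** * Density of trigonometric polynomials *)

Section bernoulli_powers.
Variable R : realType.
Implicit Types y t : R.

Lemma bernoulli_ge (y : R) (N : nat) : -1 <= y -> 1 + N%:R * y <= (1 + y) ^+ N.
Proof.
move=> y1; elim: N => [|N IH]; first by rewrite expr0 mul0r addr0.
have y2 : 0 <= 1 + y by lra.
rewrite exprSr; apply: le_trans (ler_wpM2r y2 IH).
have : 0 <= N%:R * y ^+ 2 by rewrite mulr_ge0 ?sqr_ge0.
rewrite -natr1; lra.
Qed.

(** As [n] grows these polynomials in [y] tend to the indicator of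
    [k * s * y < 1]; the integer exponent [k ^ n] is what makes them
    polynomials. *)
Definition bernoulli_power (s : R) (k n : nat) (y : R) : R :=
  (1 - (s * y) ^+ n) ^+ (k ^ n)%N.

Lemma bernoulli_power_itv s k n y : 0 <= s -> s <= 1 -> 0 <= y <= 1 ->
  0 <= bernoulli_power s k n y <= 1.
Proof.
move=> s0 s1 /andP[y0 y1].
have z0 : 0 <= s * y by rewrite mulr_ge0.
have z1 : (s * y) ^+ n <= 1 by rewrite exprn_ile1// mulr_ile1.
have z2 : 0 <= (s * y) ^+ n by rewrite exprn_ge0.
by rewrite /bernoulli_power exprn_ge0 ?exprn_ile1//; lra.
Qed.

(** Bernoulli's inequality bounds the power below by [1 - (k s y)^n]. *)
Lemma bernoulli_power_cvg1 s k y : (0 < k)%N -> 0 <= s -> s <= 1 -> 0 <= y <= 1 ->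
  k%:R * s * y < 1 -> bernoulli_power s k ^~ y @ \oo --> (1 : R).
Proof.
move=> k0 s0 s1 y01 ksy.
have kr : (0 : R) < k%:R by rewrite ltr0n.
have /andP[y0 y1] := y01.
have z0 : 0 <= k%:R * s * y by rewrite !mulr_ge0// ltW.
apply: (@squeeze_cvgr _ _ _ _ (fun n => 1 - (k%:R * s * y) ^+ n) (fun=> 1)).
- apply: nearW => n; have := bernoulli_power_itv k n s0 s1 y01 => /andP[_ ->].
  rewrite andbT /bernoulli_power.
  have : -1 <= - (s * y) ^+ n by rewrite lerN2 exprn_ile1 ?mulr_ile1// mulr_ge0.
  move=> /(bernoulli_ge (k ^ n)); apply: le_trans.
  by rewrite mulrN -mulrA exprMn natrX.
- rewrite -[X in _ --> X](subr0 1); apply: cvgB; first exact: cvg_cst.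
  by apply: cvg_expr; rewrite ger0_norm.
- exact: cvg_cst.
Qed.

(** As [(1 - u)(1 + u) <= 1], the power is at most the inverse of
    [(1 + u)^(k^n)], and Bernoulli's inequality makes this at least
    [(k s y)^n]. *)
Lemma bernoulli_power_cvg0 s k y : 0 <= s -> s <= 1 -> 0 <= y <= 1 ->
  1 < k%:R * s * y -> bernoulli_power s k ^~ y @ \oo --> (0 : R).
Proof.
move=> s0 s1 y01 ksy; have /andP[y0 y1] := y01.
have z0 : 0 < k%:R * s * y by apply: lt_trans ksy.
apply: (@squeeze_cvgr _ _ _ _ (fun=> 0) (fun n => (k%:R * s * y)^-1 ^+ n)).
- apply: nearW => n; have := bernoulli_power_itv k n s0 s1 y01 => /andP[-> _] /=.
  set u := (s * y) ^+ n; set K := (k ^ n)%N.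
  have u0 : 0 <= u by rewrite exprn_ge0// mulr_ge0.
  have u1 : u <= 1 by rewrite exprn_ile1 ?mulr_ile1// mulr_ge0.
  have Ku : K%:R * u = (k%:R * s * y) ^+ n by rewrite -mulrA exprMn natrX.
  have Ku0 : 0 < K%:R * u by rewrite Ku exprn_gt0.
  rewrite exprVn -Ku /bernoulli_power -/u -/K -[leRHS]mul1r ler_pdivlMr//.
  have h1 : K%:R * u <= (1 + u) ^+ K.
    have : -1 <= u by lra.
    by move=> /(bernoulli_ge K); apply: le_trans; lra.
  have v0 : 0 <= (1 - u) ^+ K by rewrite exprn_ge0//; lra.
  apply: (le_trans (ler_wpM2l v0 h1)); rewrite -exprMn.
  apply: exprn_ile1.
    by rewrite mulr_ge0; lra.
  have := sqr_ge0 u; rewrite expr2; lra.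
- exact: cvg_cst.
- by apply: cvg_expr; rewrite ger0_norm ?invr_ge0 ?(ltW z0)// invf_lt1.
Qed.

End bernoulli_powers.

Section trigonometric_density.
Variable R : realType.
Variables (b c : R) (b_gt0 : 0 < b).
Local Notation mu := (@lebesgue_measure R).
Local Notation J := (`[c, c + b^-1[%classic : set R).
Implicit Types (A B : set R) (q : R -> R).

Definition trig (q : R -> R[i]) := exists s : seq (R[i] * int),
  forall x, q x = \sum_(m <- s) m.1 * cis (2 * pi * (m.2%:~R * b) * x).

Lemma trig_cis (z : R[i]) (m : int) (d : R) :
  trig (fun x => z * cis (2 * pi * (m%:~R * b) * (x - d))).
Proof.
exists [:: (z * cis (- (2 * pi * (m%:~R * b) * d)), m)] => x.
by rewrite big_seq1 /= -[RHS]mulrA -cisD; congr (_ * cis _); ring.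
Qed.

Lemma trig_cst (z : R[i]) : trig (fun=> z).
Proof.
have [s hs] := trig_cis z 0 0; exists s => x; rewrite -hs.
by rewrite !(mul0r, mulr0) cis0 mulr1.
Qed.

Lemma trigD (q1 q2 : R -> R[i]) : trig q1 -> trig q2 -> trig (fun x => q1 x + q2 x).
Proof. by move=> [s hs] [t ht]; exists (s ++ t) => x; rewrite big_cat hs ht. Qed.

Lemma trigM (q1 q2 : R -> R[i]) : trig q1 -> trig q2 -> trig (fun x => q1 x * q2 x).
Proof.
move=> [s hs] [t ht].
exists [seq (m.1 * k.1, m.2 + k.2) | m <- s, k <- t] => x.
rewrite hs ht big_distrlr /= big_allpairs_dep; apply: eq_bigr => m _.
apply: eq_bigr => k _ /=.
rewrite mulrACA -cisD; congr (_ * cis _); rewrite intrD; ring.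
Qed.

(** The range condition makes products of approximations of indicators
    approximate the products of the indicators. *)
Definition rtrig q :=
  [/\ trig (fun x => (q x)%:C%C), measurable_fun setT q & forall x, 0 <= q x <= 1].

Lemma rtrigM q q' : rtrig q -> rtrig q' -> rtrig (fun x => q x * q' x).
Proof.
move=> [tq mq q01] [tq' mq' q'01]; split.
- have := trigM tq tq'; rewrite (_ : (fun x => _ * _) = fun x => (q x * q' x)%:C%C)//.
  by apply/funext => x; rewrite rmorphM.
- exact: measurable_funM.
- move=> x; have /andP[? ?] := q01 x; have /andP[? ?] := q'01 x.
  by rewrite mulr_ge0//= mulr_ile1.
Qed.

Lemma rtrig_cst s : 0 <= s <= 1 -> rtrig (fun=> s).
Proof. by move=> s01; split => //; exact: trig_cst. Qed.

Lemma rtrigX q n : rtrig q -> rtrig (fun x => q x ^+ n).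
Proof.
move=> hq; elim: n => [|n IH]; first by apply: rtrig_cst; rewrite ler01 lexx.
by under eq_fun do rewrite exprS; exact: rtrigM.
Qed.

Lemma rtrig1B q : rtrig q -> rtrig (fun x => 1 - q x).
Proof.
move=> [tq mq q01]; split.
- have := trigD (trig_cst 1) (trigM (trig_cst (-1)) tq).
  rewrite (_ : (fun x => 1 + _) = fun x => (1 - q x)%:C%C)//.
  by apply/funext => x; rewrite mulN1r rmorphB.
- exact: measurable_funB.
- by move=> x; have /andP[? ?] := q01 x; apply/andP; split; lra.
Qed.

(** Its sublevel sets are the complements of the arcs centred at [d]. *)
Lemma rtrig_arc d : rtrig (fun x => (1 + cos (2 * pi * b * (x - d))) / 2).
Proof.
split.
- have h := trigD (trig_cst (2^-1)) (trigD (trig_cis (4^-1) 1 d) (trig_cis (4^-1) (-1) d)).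
  suff -> : (fun x => ((1 + cos (2 * pi * b * (x - d))) / 2)%:C%C) =
    (fun x => 2^-1 + (4^-1 * cis (2 * pi * (1%:~R * b) * (x - d)) +
      4^-1 * cis (2 * pi * ((-1)%:~R * b) * (x - d)))) by [].
  apply/funext => x; rewrite mulrN1z mulr1z !(mulNr, mulrN) !mul1r.
  set y := 2 * pi * b * _.
  have e n : (n%:R : R[i])^-1 = (n%:R^-1)%:C%C by rewrite fmorphV rmorph_nat.
  rewrite !e; apply: complex_eqP; rewrite !complex_parts /= cosN ?sinN; lra.
- apply: measurable_funM => //; apply: measurable_funD => //.
  have mcos : measurable_fun [set: R] (@cos R).
    by apply: continuous_measurable_fun; exact: continuous_cos.
  apply: (measurableT_comp mcos).
  by apply: measurable_funM => //; exact: measurable_funB.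
- move=> x; have := cos_geN1 (2 * pi * b * (x - d)); have := cos_le1 (2 * pi * b * (x - d)).
  by move=> *; apply/andP; split; lra.
Qed.

Lemma measurable_period : measurable J. Proof. exact: measurable_itv. Qed.
Lemma mu_period : mu J = (b^-1)%:E.
Proof. by rewrite lebesgue_measure_itv /= lte_fin ltrDl invr_gt0 b_gt0 -EFinB addrAC subrr add0r. Qed.
Let mu_period_lty : (mu J < +oo)%E. Proof. by rewrite mu_period ltry. Qed.

Let integrable_dist q A : measurable_fun setT q -> (forall x, 0 <= q x <= 1) ->
  measurable A -> mu.-integrable J (EFin \o (fun x => `|q x - \1_A x|)).
Proof.
move=> mq q01 mA; apply: measurable_bounded_integrable => //.
  apply: measurable_funTS; apply: measurableT_comp => //.
  by apply: measurable_funB => //.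
exists 1; split => // M M1 x _ /=; rewrite normr_id; apply: le_trans (ltW M1).
have /andP[? ?] := q01 x; rewrite indicE ler_norml; case: (_ \in _); apply/andP; split => /=; lra.
Qed.

Let integrable_dist2 q q' A B : measurable_fun setT q -> (forall x, 0 <= q x <= 1) ->
  measurable_fun setT q' -> (forall x, 0 <= q' x <= 1) ->
  measurable A -> measurable B ->
  mu.-integrable J (EFin \o (fun x => `|q x - \1_A x| + `|q' x - \1_B x|)).
Proof.
move=> mq q01 mq' q'01 mA mB; apply: measurable_bounded_integrable => //.
  by apply: measurable_funTS; apply: measurable_funD; apply: measurableT_comp => //;
    apply: measurable_funB => //.
exists 2; split => // M M2 x _ /=.
have /andP[? ?] := q01 x; have /andP[? ?] := q'01 x.
rewrite ger0_norm ?addr_ge0//; apply: le_trans (ltW M2).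
rewrite (_ : 2 = 1 + 1)// lerD// indicE ler_norml;
  by case: (_ \in _); apply/andP; split => /=; lra.
Qed.

Let dist_dominated (F : nat -> R -> R) A : (forall n, measurable_fun setT (F n)) ->
  (forall n x, 0 <= F n x <= 1) -> measurable A ->
  {ae mu, forall x, J x -> F ^~ x @ \oo --> (\1_A x : R)} ->
  forall eta, 0 < eta -> exists n, \int[mu]_(x in J) `|F n x - \1_A x| <= eta.
Proof.
move=> mF F01 mA FA eta eta0.
have FF : Filter (nbhs (almost_everywhere mu)) := ae_filter_ringOfSetsType mu.
have [|||||_ _ h] := @dominated_convergence _ _ _ mu J measurable_period
  (fun n => EFin \o (fun x => `|F n x - \1_A x|)) (cst 0%E)
  (EFin \o cst 1).
- move=> n; apply/measurable_EFinP/measurable_funTS; apply: measurableT_comp => //.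
  by apply: measurable_funB => //; exact: mF.
- exact: measurable_cst.
- apply: filterS FA => x h Jx.
  have h' : (fun n => `|F n x - \1_A x|) @ \oo --> `|(\1_A x : R) - \1_A x|.
    by apply: cvg_norm; apply: cvgB; [exact: h|exact: cvg_cst].
  rewrite subrr normr0 in h'.
  exact: (@cvg_comp _ _ _ _ EFin _ _ _ h').
- apply: measurable_bounded_integrable => //.
  by exists 1; split => // M M1 x _ /=; rewrite normr1 ltW.
- apply: aeW => x n _ /=; rewrite lee_fin normr_id.
  have /andP[? ?] := F01 n x; rewrite indicE ler_norml.
  by case: (_ \in _); apply/andP; split => /=; lra.
rewrite integral0 in h.
have : (fun n => \int[mu]_(x in J) `|F n x - \1_A x|) @ \oo --> (0 : R).
  exact: (fine_cvg h).
move=> /cvgrPdist_le/(_ _ eta0)[n _ hn]; exists n.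
by have := hn n (leqnn n); rewrite sub0r normrN => /(le_trans (ler_norm _)).
Qed.

Definition trig_approximable A := measurable A /\ forall eta, 0 < eta ->
  exists2 q, rtrig q & \int[mu]_(x in J) `|q x - \1_A x| <= eta.

Let approxC A : trig_approximable A -> trig_approximable (~` A).
Proof.
move=> [mA hA]; split; first exact: measurableC.
move=> eta eta0; have [q tq hq] := hA _ eta0; exists (fun x => 1 - q x); first exact: rtrig1B.
apply: le_trans hq; rewrite le_eqVlt; apply/orP; left; apply/eqP.
apply: eq_Rintegral => x _; rewrite !indicE in_setC.
by case: (x \in A); rewrite /= ?subr0 -normrN; congr `| _ |; ring.
Qed.

Let approxI A B : trig_approximable A -> trig_approximable B ->
  trig_approximable (A `&` B).
Proof.
move=> [mA hA] [mB hB]; split; first exact: measurableI.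
move=> eta eta0; have e2 : 0 < eta / 2 by rewrite divr_gt0.
have [q tq hq] := hA _ e2; have [q' tq' hq'] := hB _ e2.
exists (fun x => q x * q' x); first exact: rtrigM.
have [_ mq q01] := tq; have [_ mq' q'01] := tq'; have [_ mqq qq01] := rtrigM tq tq'.
apply: (@le_trans _ _ (\int[mu]_(x in J) (`|q x - \1_A x| + `|q' x - \1_B x|))).
  apply: le_Rintegral => //.
  - by apply: integrable_dist => //; exact: measurableI.
  - exact: integrable_dist2.
  move=> x _; rewrite indicI /=.
  have -> : q x * q' x - \1_A x * \1_B x =
    (q x - \1_A x) * q' x + \1_A x * (q' x - \1_B x) by ring.
  apply: (le_trans (ler_normD _ _)); rewrite !normrM lerD//.
    by rewrite ler_piMr//; have /andP[? ?] := q'01 x; rewrite ger0_norm.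
  by rewrite ler_piMl// indicE; case: (_ \in _); rewrite ?normr1 ?normr0.
rewrite RintegralD//; [|exact: integrable_dist..].
by rewrite [leRHS](splitr eta) lerD.
Qed.

Let approx_limit (B : nat -> set R) A : (forall n, trig_approximable (B n)) ->
  measurable A ->
  {ae mu, forall x, J x -> (fun n => \1_(B n) x : R) @ \oo --> (\1_A x : R)} ->
  trig_approximable A.
Proof.
move=> hB mA BA; split => // eta eta0; have e2 : 0 < eta / 2 by rewrite divr_gt0.
have mB n : measurable (B n) by have [] := hB n.
have ind01 (D : set R) x : 0 <= (\1_D x : R) <= 1.
  by rewrite indicE; case: (_ \in _); rewrite /= ?lexx ?ler01.
have [n hn] := @dist_dominated (fun n => \1_(B n)) A (fun n => measurable_indic (mB n))
  (fun n => ind01 (B n)) mA BA _ e2.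
have [_ /(_ _ e2)[q tq hq]] := hB n; exists q => //; have [_ mq q01] := tq.
apply: (@le_trans _ _ (\int[mu]_(x in J)
    (`|q x - \1_(B n) x| + `|(\1_(B n) x : R) - \1_A x|))).
  apply: le_Rintegral => //.
  - exact: integrable_dist.
  - by apply: integrable_dist2 => //; exact: measurable_indic.
  by move=> x _ /=; rewrite -[X in `|X|](subrKA (\1_(B n) x)) ler_normD.
rewrite RintegralD//; last 2 first.
- exact: integrable_dist.
- by apply: integrable_dist => //; exact: measurable_indic.
by rewrite [leRHS](splitr eta) lerD.
Qed.

(** Sublevel sets of [q], up to a null set: rescale [q] so that the threshold [t]
    becomes the inverse of an integer and apply the Bernoulli powers. *)
Let approx_bernoulli q t A : rtrig q -> 0 < t < 1 -> measurable A ->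
  {ae mu, forall x, J x -> (x \in A -> q x < t) /\ (x \notin A -> t < q x)} ->
  trig_approximable A.
Proof.
move=> tq /andP[t0 t1] mA Aq; split=> // eta eta0; have [_ mq q01] := tq.
pose k := (Num.truncn t^-1).+1.
have kt : 1 < k%:R * t by rewrite -ltr_pdivrMr// mul1r truncnS_gt.
have k0 : (0 : R) < k%:R by rewrite ltr0n.
pose s := (k%:R * t)^-1.
have s0 : 0 < s by rewrite invr_gt0 mulr_gt0.
have s1 : s <= 1 by rewrite invf_le1 ?ltW// mulr_gt0.
have kst y : k%:R * s * y = y / t.
  by rewrite /s; field; rewrite !gt_eqF.
have tF n : rtrig (fun x => bernoulli_power s k n (q x)).
  apply: rtrigX; apply: rtrig1B; apply: rtrigX; apply: rtrigM => //.
  by apply: rtrig_cst; rewrite (ltW s0).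
have FF : Filter (nbhs (almost_everywhere mu)) := ae_filter_ringOfSetsType mu.
have [|||n hn] := @dist_dominated (fun n x => bernoulli_power s k n (q x)) A _ _ mA _ _ eta0.
- by move=> n; have [] := tF n.
- by move=> n x; have [_ _] := tF n; apply.
- apply: filterS Aq => x h /h[h1 h2]; rewrite indicE; have [xA|xA] := boolP (x \in A) => /=.
  + apply: bernoulli_power_cvg1 => //; first exact: ltW.
    by rewrite kst ltr_pdivrMr// mul1r h1.
  + apply: bernoulli_power_cvg0 => //; first exact: ltW.
    by rewrite kst ltr_pdivlMr// mul1r h2.
by exists (fun x => bernoulli_power s k n (q x)).
Qed.

Let ae_neq (t : R) : {ae mu, forall x, x != t}.
Proof.
exists [set t]; split; [exact: measurable_set1|exact: lebesgue_measure_set1|].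
by move=> x /= /negP; rewrite negbK => /eqP.
Qed.

Let approx_const A (z : bool) : measurable A ->
  (forall x, J x -> (x \in A) = z) -> trig_approximable A.
Proof.
move=> mA Az; apply: (@approx_bernoulli (fun=> (~~ z)%:R) (2^-1)) => //.
- by apply: rtrig_cst; case: z {Az}; rewrite /= ?lexx ?ler01.
- by apply/andP; split; lra.
- by apply: aeW => x Jx; rewrite (Az x Jx); case: z {Az} => /=; split => // _; lra.
Qed.

(** In the period that starts at [c], the points to the right of [t] are those of
    the arc with centre [d] and length [c + b^-1 - t]; [al] is its half-length as
    an angle. *)
Let arc_separation t x : c < t -> t < c + b^-1 -> J x -> x != t -> x != c ->
  let d := (t + c + b^-1) / 2 in let al := pi * b * (c + b^-1 - t) in
  (x < t -> cos (2 * pi * b * (x - d)) < cos al) /\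
  (t < x -> cos al < cos (2 * pi * b * (x - d))).
Proof.
move=> ct tp Jx xt xc d al; move: Jx; rewrite /= in_itv /= => /andP[cx xp].
have {cx}xc : c < x by rewrite lt_neqAle eq_sym xc.
have p0 := pi_gt0 R.
have pb : 0 < pi * b by rewrite mulr_gt0.
have pbb : pi * b * b^-1 = pi by rewrite mulfK// gt_eqF.
have al0 : 0 < al by rewrite mulr_gt0//; lra.
have alpi : al < pi by rewrite -[ltRHS]pbb ltr_pM2l//; lra.
have alI : al \in `[0, pi] by rewrite in_itv /= !ltW.
set th := 2 * pi * b * (x - d).
have thE : th = pi * b * (2 * x - t - c - b^-1) by rewrite /th /d; field; rewrite gt_eqF.
have thal : th - al = pi * b * (2 * (x - c - b^-1)).
  by rewrite thE /al; ring.
have thal2 : th + al = pi * b * (2 * (x - t)) by rewrite thE /al; ring.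
have h1 : th < al.
  by rewrite -subr_lt0 thal pmulr_rlt0//; lra.
split => [xlt|tx].
- have h2 : th < - al by rewrite -subr_lt0 opprK thal2 pmulr_rlt0//; lra.
  have h3 : al - 2 * pi < th.
    have -> : al - 2 * pi = th - pi * b * (2 * (x - c)).
      have -> : 2 * pi = 2 * (pi * b * b^-1) by rewrite pbb.
      by rewrite thE /al; ring.
    by rewrite ltrBlDr ltrDl mulr_gt0//; lra.
  rewrite -(cosN th); have [thpi|thpi] := leP (- th) pi.
    by rewrite ltr_cos// ?in_itv /=; [|apply/andP; split]; lra.
  have -> : cos (- th) = cos (2 * pi + th).
    by rewrite -[RHS]cosN -[RHS]cosD2pi; congr cos; rewrite mulr2n; lra.
  by rewrite ltr_cos// ?in_itv /=; [|apply/andP; split]; lra.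
- have h2 : - al < th by rewrite -subr_gt0 opprK thal2 pmulr_rgt0//; lra.
  have h4 : `|th| < al by rewrite ltr_norml h1 h2.
  by rewrite -(cos_norm th) ltr_cos// in_itv /= normr_ge0 /=; lra.
Qed.

Let approx_ray t : trig_approximable `]-oo, t[%classic.
Proof.
have mA : measurable `]-oo, t[%classic by exact: measurable_itv.
have [tc|ct] := leP t c.
  apply: (@approx_const _ false) => // x Jx.
  have /andP[cx _] : c <= x < c + b^-1 by move: Jx; rewrite /= in_itv.
  by apply/negbTE; rewrite notin_setE /= in_itv /= => xt; lra.
have [pt|tp] := leP (c + b^-1) t.
  apply: (@approx_const _ true) => // x Jx.
  have /andP[_ xp] : c <= x < c + b^-1 by move: Jx; rewrite /= in_itv.
  by apply: mem_set; rewrite /= in_itv /=; lra.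
pose d := (t + c + b^-1) / 2; pose al := pi * b * (c + b^-1 - t).
have p0 := pi_gt0 R.
have pb : 0 < pi * b by rewrite mulr_gt0.
have pbb : pi * b * b^-1 = pi by rewrite mulfK// gt_eqF.
have al0 : 0 < al by rewrite mulr_gt0//; lra.
have alpi : al < pi by rewrite -[ltRHS]pbb ltr_pM2l//; lra.
have alI : al \in `[0, pi] by rewrite in_itv /= !ltW.
have I0 : 0 \in `[0, (pi : R)] by rewrite in_itv /= lexx ltW.
have Ipi : pi \in `[0, (pi : R)] by rewrite in_itv /= lexx ltW.
have c1 : cos al < 1 by rewrite -cos0 ltr_cos.
have c2 : - 1 < cos al by rewrite -cospi ltr_cos.
apply: (@approx_bernoulli _ ((1 + cos al) / 2) _ (rtrig_arc d)) => //.
  by apply/andP; split; lra.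
have FF : Filter (nbhs (almost_everywhere mu)) := ae_filter_ringOfSetsType mu.
apply: filterS2 (ae_neq t) (ae_neq c) => x xt xc Jx.
have [h1 h2] := arc_separation ct tp Jx xt xc.
split.
  by move=> /set_mem; rewrite /= in_itv /= => /h1; lra.
rewrite notin_setE /= in_itv /= => /negP; rewrite -leNgt => tx.
have : t < x by rewrite lt_neqAle eq_sym xt.
by move=> /h2; lra.
Qed.

Lemma measurable_trig_approximable A : measurable A -> trig_approximable A.
Proof.
have ap0 : trig_approximable set0.
  by apply: (@approx_const _ false) => // x _; rewrite in_set0.
have apU C D : trig_approximable C -> trig_approximable D -> trig_approximable (C `|` D).
  by move=> hC hD; rewrite -[C `|` D]setCK setCU; apply/approxC/approxI; exact: approxC.
have apbig (F : nat -> set R) n : (forall i, trig_approximable (F i)) ->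
    trig_approximable (\big[setU/set0]_(i < n) F i).
  by move=> hF; elim/big_ind : _ => // *; exact: apU.
have sa : sigma_algebra [set: R] trig_approximable.
  split => // [B hB|F hF]; first by rewrite setTD; exact: approxC.
  apply: (@approx_limit (fun n => \big[setU/set0]_(i < n) F i)) => //.
  - by move=> n; exact: apbig.
  - by apply: bigcup_measurable => i _; have [] := hF i.
  - apply: aeW => x _; have [[i _ Fx]|nF] := pselect ((\bigcup_i F i) x).
      rewrite [\1__ x]indicE mem_set; last by exists i.
      apply: cvg_near_cst; exists i.+1 => // n /= ilen.
      rewrite indicE mem_set// -bigcup_mkord; exists i => //.
    rewrite [\1__ x]indicE memNset//; apply: cvg_near_cst; exists 0%N => // n /= _.
    rewrite indicE memNset// -bigcup_mkord => -[i _ Fx]; apply: nF; by exists i.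
move=> mA; have : (@RGenInftyO.G R).-sigma.-measurable A.
  by rewrite -RGenInftyO.measurableE.
by apply: smallest_sub => // B [t ->]; exact: approx_ray.
Qed.

End trigonometric_density.

(** * Fourier expansion on an interval of length [1 / b] *)

Section layer_cake.
Variable R : realType.

Lemma sum_steps (z : R) (N : nat) : 0 <= z -> z <= N%:R ->
  z - 1 <= \sum_(k < N) (k.+1%:R <= z)%R%:R <= z.
Proof.
move=> z0; elim: N => [|N IH] zN.
  by rewrite big_ord0; apply/andP; split; lra.
rewrite big_ord_recr /=; have [zN'|zN'] := leP z N%:R.
  have -> : (N.+1%:R <= z) = false by apply/negbTE; rewrite -ltNge -natr1; lra.
  by rewrite addr0; exact: IH.
rewrite (eq_bigr (fun=> 1)); last first.
  move=> k _; suff -> : (k.+1%:R : R) <= z by [].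
  by apply: le_trans (ltW zN'); rewrite ler_nat.
rewrite sumr_const card_ord; have [zN1|zN1] /= := leP N.+1%:R z.
  by move: zN zN1; rewrite -natr1 => *; apply/andP; split; lra.
by move: zN1; rewrite -natr1 => *; apply/andP; split; lra.
Qed.

(** A bounded function is within [d] of a combination of the indicators of its
    upper level sets, the levels being spaced by [d]. *)
Lemma layer_approx (y M d : R) (N : nat) : (0 < N)%N -> 0 < M -> `|y| <= M ->
  d = 2 * M / N%:R ->
  `|y - (\sum_(k < N) (d * (- M + d * k.+1%:R <= y)%R%:R) - M)| <= d.
Proof.
move=> N0 M0 yM dE.
have N0' : (0 : R) < N%:R by rewrite ltr0n.
have d0 : 0 < d by rewrite dE divr_gt0// mulr_gt0.
have dN : d * N%:R = 2 * M by rewrite dE divfK// gt_eqF.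
have /andP[y1 y2] : - M <= y <= M by rewrite -ler_norml.
pose z := (y + M) / d.
have zd : z * d = y + M by rewrite divfK// gt_eqF.
have z0 : 0 <= z by rewrite divr_ge0 ?(ltW d0)//; lra.
have zN : z <= N%:R by rewrite ler_pdivrMr// mulrC dN; lra.
rewrite -mulr_sumr (eq_bigr (fun k : 'I_N => (k.+1%:R <= z)%R%:R)); last first.
  by move=> k _; congr ((nat_of_bool _)%:R); rewrite ler_pdivlMr// addrC lerBlDr mulrC.
have /andP[h1 h2] := sum_steps z0 zN.
have h1' := ler_wpM2r (ltW d0) h1; have h2' := ler_wpM2r (ltW d0) h2.
by rewrite ler_norml; apply/andP; split; lra.
Qed.

End layer_cake.

Section fourier.
Variable R : realType.
Variables (b c : R) (b_gt0 : 0 < b).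
Local Notation mu := (@lebesgue_measure R).
Local Notation J := (`[c, c + b^-1[%classic : set R).
Local Notation l2fun := (l2fun R).
Local Notation L2 := (L2 R).
Local Notation n2 := (sqn (@inner R)).
Local Notation pi2 := (\pi_L2%qT : l2fun -> L2).
Let HI := semi_inner_inner R.

Lemma integral_derivative (F f : R -> R) (x y : R) : x < y ->
  (forall z : R, is_derive z 1 F (f z)) -> continuous f ->
  \int[mu]_(z in `[x, y[) f z = F y - F x.
Proof.
move=> xy dF cf.
have cF : continuous F.
  move=> z; apply: differentiable_continuous; apply/derivable1_diffP.
  exact: ex_derive.
rewrite Rintegral_itv_bndo_bndc; last first.
  have iI : mu.-integrable `[x, y] (EFin \o f).
    by apply: continuous_compact_integrable; [exact: segment_compact|exact: continuous_subspaceT].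
  apply: (integrableS _ _ _ iI); [exact: measurable_itv|exact: measurable_itv|].
  by apply: subset_itvl; rewrite bnd_simp.
rewrite /Rintegral (@continuous_FTC2 _ f F)//.
- exact: continuous_subspaceT.
- split=> [z _||]; first exact: ex_derive.
  + by apply: cvg_at_right_filter; exact: cF.
  + by apply: cvg_at_left_filter; exact: cF.
- by move=> z _; rewrite derive1E derive_val.
Qed.

(** The primitives take the same values at both ends of the period. *)
Lemma integral_cis_period (j : int) : j != 0 ->
  \int[mu]_(x in J) cos (2 * pi * (j%:~R * b) * x) = 0 /\
  \int[mu]_(x in J) sin (2 * pi * (j%:~R * b) * x) = 0.
Proof.
move=> j0; set w := 2 * pi * (j%:~R * b).
have w0 : w != 0.
  apply: mulf_neq0; first by rewrite mulf_neq0// gt_eqF// pi_gt0.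
  by rewrite mulf_neq0 ?intr_eq0// gt_eqF.
have cp : c < c + b^-1 by rewrite ltrDl invr_gt0.
have per : w * (c + b^-1) = w * c + j%:~R * (pi *+ 2).
  by rewrite /w; field; rewrite gt_eqF.
have periodz (f : R -> R) y : periodic f (pi *+ 2) -> f (y + j%:~R * (pi *+ 2)) = f y.
  move=> pf; clear per; case: j {j0 w w0} => n.
    by rewrite -[(Posz n)%:~R]/(n%:R) mulr_natl periodicn.
  rewrite -[(Negz n)%:~R]/(- n.+1%:R) mulNr mulr_natl.
  by rewrite -[LHS](periodicn pf n.+1) subrK.
have sE : sin (w * (c + b^-1)) = sin (w * c) by rewrite per periodz//; exact: sinD2pi.
have complex_parts' : cos (w * (c + b^-1)) = cos (w * c) by rewrite per periodz//; exact: cosD2pi.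
split.
- have dF (z : R) : is_derive z 1 (fun x => w^-1 * sin (w * x)) (cos (w * z)).
    have h : is_derive z 1 (w^-1 \*: (@sin R \o (w \*: id)))
      (w^-1 *: (cos (w *: z) * (w *: 1))) by exact: is_deriveZ.
    by apply: (is_derive_eq h); rewrite -[LHS]/(w^-1 * (cos (w * z) * (w * 1))); field.
  have cf : continuous (fun x : R => cos (w * x)).
    by move=> z; apply: continuous_comp; [exact: mulrl_continuous|exact: continuous_cos].
  by rewrite (integral_derivative cp dF cf) sE subrr.
- have dF (z : R) : is_derive z 1 (fun x => - w^-1 * cos (w * x)) (sin (w * z)).
    have h : is_derive z 1 (- w^-1 \*: (@cos R \o (w \*: id)))
      (- w^-1 *: (- sin (w *: z) * (w *: 1))) by exact: is_deriveZ.
    by apply: (is_derive_eq h); rewrite -[LHS]/(- w^-1 * (- sin (w * z) * (w * 1))); field.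
  have cf : continuous (fun x : R => sin (w * x)).
    by move=> z; apply: continuous_comp; [exact: mulrl_continuous|exact: continuous_sin].
  by rewrite (integral_derivative cp dF cf) complex_parts' subrr.
Qed.

End fourier.

Section frequencies.

Definition frequencies (M : nat) : seq int := [seq k%:Z - M%:Z | k <- iota 0 (M.*2.+1)].

Lemma frequencies_uniq M : uniq (frequencies M).
Proof. by rewrite map_inj_uniq ?iota_uniq// => k l /addIr[]. Qed.

Lemma mem_frequencies M (m : int) : (m \in frequencies M) = (`|m| <= M%:Z).
Proof.
apply/mapP/idP => [[k]|mM].
  by rewrite mem_iota add0n => /andP[_ kM] ->; lia.
by exists (absz (m + M%:Z)%R); [rewrite mem_iota add0n; lia|lia].
Qed.

Lemma sum_frequencies_opp (V : nmodType) M (F : int -> V) :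
  \sum_(m <- frequencies M) F (- m) = \sum_(m <- frequencies M) F m.
Proof.
rewrite -(big_map -%R xpredT F); apply: perm_big; apply: uniq_perm.
- by rewrite map_inj_uniq ?frequencies_uniq//; exact: oppr_inj.
- exact: frequencies_uniq.
move=> m; rewrite mem_frequencies; apply/mapP/idP => [[k]|mM].
  by rewrite mem_frequencies => kM ->; rewrite normrN.
by exists (- m); rewrite ?opprK// mem_frequencies normrN.
Qed.

End frequencies.

Section fourier_expansion.
Variable R : realType.
Variables (b c : R) (b_gt0 : 0 < b).
Local Notation mu := (@lebesgue_measure R).
Local Notation J := (`[c, c + b^-1[%classic : set R).
Local Notation l2fun := (l2fun R).
Local Notation L2 := (L2 R).
Local Notation n2 := (sqn (@inner R)).
Local Notation pi2 := (\pi_L2%qT : l2fun -> L2).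
Let HI := semi_inner_inner R.
Implicit Types (f g h : l2fun) (u v w : L2) (z : R[i]).

Let mJ : measurable J. Proof. exact: measurable_itv. Qed.
Let finJ : (mu J < +oo)%E.
Proof. by rewrite mu_period ?ltry. Qed.

Definition period_one : L2 := indicL2 mJ finJ.
Definition wave (m : int) : L2 := modulation (m%:~R * b) period_one.

Let wave_pi m : wave m = pi2 (l2modulate (m%:~R * b) (l2indic mJ finJ)).
Proof. by rewrite /wave /period_one /indicL2 pi_modulation. Qed.

Lemma wave_orthogonal m k : inner (wave m) (wave k) = if m == k then (b^-1)%:C%C else 0.
Proof.
have [<-|mk] := eqVneq m k.
  rewrite (si_uu HI) modulation_norm indicL2_norm.
  by congr (_%:C%C); rewrite mu_period.
rewrite !wave_pi inner_pi.
have mk0 : m - k != 0 by rewrite subr_eq0.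
have [c0 s0] := integral_cis_period c b_gt0 mk0.
have cisE x : cis (2 * pi * (m%:~R * b) * x) * (cis (2 * pi * (k%:~R * b) * x))^*%C =
    cis (2 * pi * ((m - k)%:~R * b) * x).
  by rewrite cisJ -cisD; congr cis; rewrite intrB; ring.
have prodE x : l2modulate (m%:~R * b) (l2indic mJ finJ) x *
    (l2modulate (k%:~R * b) (l2indic mJ finJ) x)^*%C =
    (\1_J x)%:C%C * cis (2 * pi * ((m - k)%:~R * b) * x).
  have wE t : l2modulate t (l2indic mJ finJ) x = cis (2 * pi * t * x) * (\1_J x)%:C%C by [].
  rewrite !wE -cisE; have [i1|i0] : (\1_J x : R) = 1 \/ (\1_J x : R) = 0.
  - by rewrite indicE; case: (_ \in _); [left|right].
  - by rewrite i1; apply: complex_eqP; rewrite !complex_parts; ring.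
  - by rewrite i0; apply: complex_eqP; rewrite !complex_parts; ring.
apply: complex_eqP; rewrite ?Re_cRintegral ?Im_cRintegral.
- rewrite -[RHS]c0 [RHS]Rintegral_mkcond; apply: eq_Rintegral => x _.
  rewrite prodE patchE !complex_parts indicE /=.
  by case: (x \in J); rewrite /= ?mul1r ?mul0r subr0.
- rewrite -[RHS]s0 [RHS]Rintegral_mkcond; apply: eq_Rintegral => x _.
  rewrite prodE patchE !complex_parts indicE /=.
  by case: (x \in J); rewrite /= ?mul1r ?mul0r addr0.
Qed.

Definition wave_sum (s : seq (R[i] * int)) : L2 := \sum_(m <- s) m.1 *: wave m.2.

Definition wave_approx u := forall eta, 0 < eta ->
  exists s, n2 (u - wave_sum s) <= eta.

Let wave_approx_lim u : (forall eta, 0 < eta -> exists2 v, wave_approx v & n2 (u - v) <= eta) ->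
  wave_approx u.
Proof.
move=> hu eta eta0; have e4 : 0 < eta / 4 by rewrite divr_gt0.
have [v hv uv] := hu _ e4; have [s hs] := hv _ e4; exists s.
have := sqnD_le HI (u - v) (v - wave_sum s); rewrite addrA subrK; lra.
Qed.

Let wave_approxD u v : wave_approx u -> wave_approx v -> wave_approx (u + v).
Proof.
move=> hu hv eta eta0; have e4 : 0 < eta / 4 by rewrite divr_gt0.
have [s hs] := hu _ e4; have [t ht] := hv _ e4; exists (s ++ t).
rewrite /wave_sum big_cat /= -/(wave_sum s) -/(wave_sum t) opprD addrACA.
have := sqnD_le HI (u - wave_sum s) (v - wave_sum t); lra.
Qed.

Let wave_approxZ z u : wave_approx u -> wave_approx (z *: u).
Proof.
move=> hu eta eta0; have d0 : 0 < eta / (sqmod z + 1).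
  by rewrite divr_gt0//; have := sqmod_ge0 z; lra.
have [s hs] := hu _ d0; exists [seq (z * m.1, m.2) | m <- s].
have -> : wave_sum [seq (z * m.1, m.2) | m <- s] = z *: wave_sum s.
  by rewrite /wave_sum big_map scaler_sumr; apply: eq_bigr => m _; rewrite scalerA.
rewrite -scalerBr (sqnZ HI).
have h0 := sqmod_ge0 z; apply: (le_trans (ler_wpM2l h0 hs)).
rewrite mulrCA ler_piMr ?(ltW eta0)// ler_pdivrMr ?mul1r; lra.
Qed.

Let wave_approx0 : wave_approx 0.
Proof. by move=> eta eta0; exists [::]; rewrite /wave_sum big_nil subr0 (sqn0 HI) ltW. Qed.

Let wave_sum_pi s : exists2 F : l2fun, pi2 F = wave_sum s &
  forall x, F x = (\sum_(m <- s) m.1 * cis (2 * pi * (m.2%:~R * b) * x)) * (\1_J x)%:C%C.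
Proof.
elim: s => [|m s [F FE FP]].
  exists 0; first by rewrite /wave_sum big_nil; by rewrite -(scale0r (0 : l2fun)) pi_L2Z scale0r.
  by move=> x; rewrite big_nil mul0r.
exists (m.1 *: l2modulate (m.2%:~R * b) (l2indic mJ finJ) + F).
  by rewrite pi_L2D pi_L2Z FE /wave_sum big_cons wave_pi.
move=> x; rewrite l2funD l2funZ FP big_cons [RHS]mulrDl; congr (_ + _).
by rewrite -[l2modulate _ _ x]/(cis _ * (\1_J x)%:C%C) mulrA.
Qed.

Let mI (A : set R) (mA : measurable A) : measurable (A `&` J).
Proof. exact: measurableI. Qed.

Let finI (A : set R) (mA : measurable A) : (mu (A `&` J) < +oo)%E.
Proof.
by apply: le_lt_trans finJ; apply: le_measure; rewrite ?inE//; exact: mI.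
Qed.

(** Between [-1] and [1] the square is at most the absolute value, so an
    approximation in mean is also one in quadratic mean. *)
Let wave_approx_indic (A : set R) (mA : measurable A) :
  wave_approx (indicL2 (mI mA) (finI mA)).
Proof.
move=> eta eta0.
have [_ /(_ _ eta0)[q [[s hs] mq q01] hq]] := measurable_trig_approximable c b_gt0 mA.
exists s; have [F <- FE] := wave_sum_pi s.
rewrite -scaleN1r -pi_L2Z -pi_L2D sqn_pi; apply: le_trans hq.
rewrite [leRHS]Rintegral_mkcond; apply: le_Rintegral => //.
- exact: integrable_sqmod.
- rewrite -restrict_EFin; apply: (iffLR (integrable_mkcond _ _)); first exact: measurable_itv.
  apply: measurable_bounded_integrable => //.
    by apply: measurable_funTS; apply: measurableT_comp => //; apply: measurable_funB => //.
  exists 1; split => // M M1 x _ /=; rewrite normr_id; apply: le_trans (ltW M1).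
  have /andP[? ?] := q01 x; rewrite indicE ler_norml.
  by case: (_ \in _); apply/andP; split => /=; lra.
move=> x _; rewrite l2funD l2funZ FE -hs /= patchE indicI /= mulN1r.
rewrite [\1_J x]indicE; case: (x \in J) => /=; last first.
  by rewrite !mulr0 subr0 sqmod0.
rewrite !mulr1 -rmorphB sqmodR -normrN opprB -real_normK ?num_real// distrC.
rewrite expr2 ler_piMr//.
have /andP[? ?] := q01 x; rewrite indicE ler_norml.
by case: (_ \in _); apply/andP; split => /=; lra.
Qed.

Lemma sqint_dominated (k : R -> R[i]) f : cmeasurable k ->
  (forall x, sqmod (k x) <= sqmod (f x)) -> k \in @sqint R.
Proof.
move=> mk kf; apply/asboolP; split=> //.
have /asboolP[mf] := valP f; apply: le_lt_trans; apply: ge0_le_integral => //.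
- by move=> x _; rewrite lee_fin sqmod_ge0.
- exact: measurable_sqmod.
- exact: measurable_sqmod.
- by move=> x _; rewrite lee_fin.
Qed.

Let wave_approx_sum (I : Type) (r : seq I) (F : I -> L2) :
  (forall i, wave_approx (F i)) -> wave_approx (\sum_(i <- r) F i).
Proof.
by move=> hF; elim/big_ind : _ => // *; exact: wave_approxD.
Qed.

Let pi_L2_sum (I : Type) (r : seq I) (F : I -> l2fun) :
  pi2 (\sum_(i <- r) F i) = \sum_(i <- r) pi2 (F i).
Proof.
elim/big_rec2: _ => [|i u f _ <-]; last by rewrite pi_L2D.
by rewrite -(scale0r (0 : l2fun)) pi_L2Z scale0r.
Qed.

Let wave_approx_bounded f (r : R -> R) (M : R) : 0 < M -> measurable_fun setT r ->
  (forall x, `|r x| <= M) -> (forall x, f x = (r x * \1_J x)%:C%C) ->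
  wave_approx (pi2 f).
Proof.
move=> M0 mr rM fE; apply: wave_approx_lim => eta eta0.
pose N := (Num.truncn (4 * M ^+ 2 / (b * eta))).+1.
have N0 : (0 : R) < N%:R by rewrite ltr0n.
pose d := 2 * M / N%:R.
have d0 : 0 < d by rewrite divr_gt0// mulr_gt0.
pose A (k : nat) := [set x | - M + d * k.+1%:R <= r x].
have mA k : measurable (A k).
  have -> : A k = [set: R] `&` r @^-1` `[- M + d * k.+1%:R, +oo[.
    by apply/seteqP; split => x /=; rewrite in_itv /= andbT// => -[].
  exact: mr.
pose F (k : nat) : l2fun := l2indic (mI (mA k)) (finI (mA k)).
pose T : l2fun := l2indic (mI measurableT) (finI measurableT).
pose S : l2fun := \sum_(k < N) (d%:C%C *: F k) + (- M%:C%C) *: T.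
have SE x : S x = ((\sum_(k < N) (d * (- M + d * k.+1%:R <= r x)%R%:R) - M) * \1_J x)%:C%C.
  rewrite /S l2funD l2funZ.
  have -> : (\sum_(k < N) (d%:C%C *: F k)) x = \sum_(k < N) (d%:C%C * F k x).
    by elim/big_rec2: _ => // k y g _ <-; rewrite l2funD l2funZ.
  have -> : T x = (\1_J x)%:C%C.
    by rewrite -[T x]/((\1_(setT `&` J) x)%:C%C) setTI.
  rewrite mulrBl rmorphB mulNr -rmorphM; congr (_ + _).
  rewrite mulr_suml rmorph_sum; apply: eq_bigr => k _.
  have -> : F k x = ((- M + d * k.+1%:R <= r x)%R%:R * \1_J x)%:C%C.
    rewrite -[LHS]/((\1_(A k `&` J) x)%:C%C) indicI.
    suff e : (\1_(A k) x : R) = (- M + d * k.+1%:R <= r x)%R%:R by rewrite -e.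
    rewrite indicE; congr ((nat_of_bool _)%:R).
    by apply/idP/idP => [/set_mem//|h]; exact: mem_set.
  by rewrite -rmorphM mulrA.
exists (pi2 S).
  rewrite /S pi_L2D pi_L2Z; apply: wave_approxD; last first.
    by apply: wave_approxZ; exact: wave_approx_indic.
  rewrite pi_L2_sum.
  apply: wave_approx_sum => k; rewrite pi_L2Z; apply: wave_approxZ.
  exact: wave_approx_indic.
have le_d : n2 (pi2 f - pi2 S) <= n2 (d%:C%C *: period_one).
  rewrite -scaleN1r -!pi_L2Z -pi_L2D; apply: le_sqn_pi => x.
  rewrite l2funD !l2funZ mulN1r fE SE -[l2indic _ _ x]/((\1_J x)%:C%C).
  rewrite -rmorphB -rmorphM !sqmodR -mulrBl [leLHS]exprMn [leRHS]exprMn.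
  rewrite ler_wpM2r ?sqr_ge0//.
  have := layer_approx (isT : (0 < N)%N) M0 (rM x) (erefl d).
  by rewrite ler_norml => /andP[h1 h2]; rewrite -subr_ge0 subr_sqr mulr_ge0//; lra.
apply: (le_trans le_d); rewrite (sqnZ HI) sqmodR indicL2_norm mu_period// /=.
have h : 4 * M ^+ 2 / (b * eta) < N%:R by exact: truncnS_gt.
have N1 : (1 : R) <= N%:R by rewrite ler1n.
have : 4 * M ^+ 2 / (b * eta) <= N%:R ^+ 2.
  by apply: (le_trans (ltW h)); rewrite expr2 ler_peMl// ltW.
rewrite ler_pdivrMr ?mulr_gt0// => h2.
rewrite ler_pdivrMr// /d expr_div_n ler_pdivrMr ?exprn_gt0// exprMn.
lra.
Qed.

(** Truncate to the set where the modulus is at most [n]: the truncations are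
    uniform limits of combinations of indicators, and they converge by dominated
    convergence. *)
Let wave_approx_cut u : wave_approx (cut mJ u).
Proof.
elim/L2_ind: u => f; rewrite pi_cut; apply: wave_approx_lim => eta eta0.
have [mRe mIm] := l2_cmeasurable f.
pose B (n : nat) := [set x | sqmod (f x) <= n%:R].
have mB n : measurable (B n).
  have -> : B n = [set: R] `&` (fun x => (sqmod (f x))%:E) @^-1` `]-oo, n%:R%:E].
    apply/seteqP; split => x /=; rewrite in_itv /= lee_fin//.
    by move=> -[].
  exact: (measurable_sqmod (l2_cmeasurable f) measurableT (emeasurable_itv _)).
pose g n : l2fun := l2cut mJ (l2cut (mB n) f).
have gE n x : g n x = (\1_J x)%:C%C * ((\1_(B n) x)%:C%C * f x) by [].
have g_approx n : wave_approx (pi2 (g n)).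
  pose re x := \1_(B n) x * Re (f x); pose im x := \1_(B n) x * Im (f x).
  have mre : measurable_fun setT re by apply: measurable_funM.
  have mim : measurable_fun setT im by apply: measurable_funM.
  have mcut (k : R -> R) : measurable_fun setT k ->
      cmeasurable (fun x => (k x * \1_J x)%:C%C : R[i]).
    move=> mk; split; last exact: measurable_cst.
    by rewrite (_ : _ \o _ = (fun x => k x * \1_J x))//; exact: measurable_funM.
  have bound (y : R) x : y ^+ 2 <= sqmod (f x) -> `|\1_(B n) x * y| <= n.+1%:R.
    move=> yf; rewrite indicE; case: (boolP (x \in B n)) => xB; last first.
      by rewrite mul0r normr0.
    rewrite mul1r; have : y ^+ 2 <= n%:R.
      by apply: (le_trans yf); move: xB => /set_mem.
    rewrite -natr1 => h; have n0 : (0 : R) <= n%:R by [].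
    by rewrite ler_norml; apply/andP; split; nra.
  have reb x : (Re (f x)) ^+ 2 <= sqmod (f x) by rewrite sqmodE lerDl sqr_ge0.
  have imb x : (Im (f x)) ^+ 2 <= sqmod (f x) by rewrite sqmodE lerDr sqr_ge0.
  have dom (k : R -> R) : (forall x, (k x) ^+ 2 <= sqmod (f x)) ->
      forall x, sqmod ((\1_(B n) x * k x * \1_J x)%:C%C : R[i]) <= sqmod (f x).
    move=> kf x; rewrite sqmodR !exprMn !indicE; have := kf x.
    by do 2 case: (_ \in _); rewrite /= ?expr1n ?expr0n ?mul1r ?mulr1 ?mul0r ?mulr0// => _;
      exact: sqmod_ge0.
  pose F1 : l2fun := L2Fun (sqint_dominated (mcut _ mre) (dom _ reb)).
  pose F2 : l2fun := L2Fun (sqint_dominated (mcut _ mim) (dom _ imb)).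
  have [j [j0 j1]] : exists j : R[i], Re j = 0 /\ Im j = 1.
    by exists (0 +i* 1)%C.
  have -> : g n = F1 + j *: F2.
    apply: val_inj; apply/funext => x /=.
    rewrite -[LHS]/(g n x) -[RHS]/(F1 x + j * F2 x) gE.
    rewrite -[F1 x]/((re x * \1_J x)%:C%C) -[F2 x]/((im x * \1_J x)%:C%C) /re /im.
    by apply: complex_eqP; rewrite !complex_parts j0 j1; ring.
  rewrite pi_L2D pi_L2Z; apply: wave_approxD; last apply: wave_approxZ.
  - apply: (@wave_approx_bounded F1 re n.+1%:R) => // x; exact: bound.
  - apply: (@wave_approx_bounded F2 im n.+1%:R) => // x; exact: bound.
have [||N hN] := @sqn_dominated R (fun n => l2cut mJ f + (-1) *: g n) f _ _ _ eta0.
- move=> n x; rewrite l2funD l2funZ gE -[l2cut _ _ x]/((\1_J x)%:C%C * f x).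
  have -> : (\1_J x)%:C%C * f x + -1 * ((\1_J x)%:C%C * ((\1_(B n) x)%:C%C * f x)) =
    (\1_J x * (1 - \1_(B n) x))%:C%C * f x.
    by rewrite rmorphM rmorphB /= rmorph1; ring.
  by rewrite sqmodM sqmodR ler_piMl ?sqmod_ge0.
- apply: aeW => x; apply: cvg_near_cst; exists (Num.truncn (sqmod (f x))).+1 => // n fn.
  rewrite l2funD l2funZ gE -[l2cut _ _ x]/((\1_J x)%:C%C * f x).
  have -> : (\1_(B n) x : R) = 1.
    rewrite indicE mem_set// /B; apply: (le_trans (ltW (truncnS_gt _))).
    by rewrite ler_nat; exact: fn.
  by rewrite mul1r mulN1r subrr sqmod0.
exists (pi2 (g N)) => //.
by have := hN N (leqnn N); rewrite pi_L2D pi_L2Z scaleN1r.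
Qed.

Definition fourier_sum (M : nat) u : L2 :=
  \sum_(m <- frequencies M) (b%:C%C * inner u (wave m)) *: wave m.

Lemma cut_wave m : cut mJ (wave m) = wave m.
Proof.
rewrite /wave cut_modulation; congr modulation; rewrite /period_one /indicL2 pi_cut.
congr (pi2 _); apply: val_inj; apply/funext => x /=.
by rewrite -rmorphM indicE; case: (_ \in _); rewrite /= ?mulr1 ?mulr0.
Qed.

(** The Fourier sum is the orthogonal projection on the span of the waves of
    frequency at most [M], hence at least as close as any given trigonometric
    polynomial of that degree. *)
Lemma fourier_expansion (mJ' : measurable J) u eta : 0 < eta ->
  exists M0 : nat, forall M, (M0 <= M)%N -> n2 (cut mJ' u - fourier_sum M u) <= eta.
Proof.
rewrite (Prop_irrelevance mJ' mJ) => eta0; have [s hs] := wave_approx_cut u eta0.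
exists (\sum_(m <- s) `|m.2|%N)%N => M sM; apply: le_trans hs.
set v := cut mJ u; set S := fourier_sum M u; set q := wave_sum s.
have orth k : k \in frequencies M -> inner (v - S) (wave k) = 0.
  move=> kM; rewrite (siBl HI) /v (cut_self_adjoint mJ) cut_wave /S /fourier_sum (si_suml HI).
  rewrite (bigD1_seq k) ?frequencies_uniq//= big1 ?addr0; last first.
    by move=> m mk; rewrite (siZl HI) wave_orthogonal (negPf mk) mulr0.
  rewrite (siZl HI) wave_orthogonal eqxx mulrAC -rmorphM mulfV ?gt_eqF//.
  by rewrite rmorph1 mul1r subrr.
have vS : inner (v - S) S = 0.
  rewrite /S /fourier_sum (si_sumr HI) -/(fourier_sum M u) -/S.
  by rewrite big_seq big1// => m mM; rewrite (siZr HI) orth// mulr0.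
have vq : inner (v - S) q = 0.
  rewrite /q /wave_sum (si_sumr HI) big_seq big1// => m ms.
  rewrite (siZr HI) orth ?mulr0// mem_frequencies -abszE lez_nat.
  apply: leq_trans sM.
  by rewrite (big_rem m)//= leq_addr.
have -> : v - q = (v - S) + (S - q) by rewrite addrA subrK.
have vSq : inner (v - S) (S - q) = 0.
  by rewrite (siDr HI (v - S) S (- q)) vS (siNr HI) vq oppr0 addr0.
rewrite (sqnD HI (v - S)) vSq -[Re 0]/(0 : R) mulr0 addr0.
by rewrite lerDl (sqn_ge0 HI).
Qed.

End fourier_expansion.

(** * Gabor systems *)

Section frame_bounds.
Variable R : realType.
Local Notation L2 := (L2 R).
Local Notation n2 := (sqn (@inner R)).
Implicit Types (h u v : L2).
Let HI := semi_inner_inner R.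

Let fsbig_fset (J : choiceType) (F : {fset J}) (x : J -> R) :
  (\sum_(j \in [set` F]) (x j)%:E = (\sum_(j <- F) x j)%:E)%E.
Proof. by rewrite fsbig_finite//= set_fsetK sumEFin. Qed.

(** Half of the lower frame bound is reached by a finite sum; taking the minimum
    with [B] orders the bounds. *)
Lemma frame_finite_sums (J : countType) (f : J -> L2) : is_frame f ->
  exists A B, [/\ 0 < A, A <= B,
    forall h (F : {fset J}), \sum_(j <- F) sqmod (inner h (f j)) <= B * n2 h &
    forall h, exists F : {fset J}, A * n2 h <= \sum_(j <- F) sqmod (inner h (f j))].
Proof.
move=> [A [B [A0 B0 hAB]]].
have upper h (F : {fset J}) : \sum_(j <- F) sqmod (inner h (f j)) <= B * n2 h.
  have /andP[_ ub] := hAB h; rewrite L2norm_sqr in ub.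
  rewrite -lee_fin -fsbig_fset; apply: le_trans ub; apply: esum_ge.
  by exists [set` F] => //; split => //; exact: finite_fset.
exists (Num.min (A / 2) B), B; split => //.
- by rewrite lt_min B0 andbT divr_gt0.
- by rewrite ge_min lexx orbT.
move=> h; have n0 : 0 <= n2 h := sqn_ge0 HI h.
apply: contrapT => nF.
have small (F : {fset J}) : \sum_(j <- F) sqmod (inner h (f j)) <= A / 2 * n2 h.
  rewrite leNgt; apply/negP => lt; apply: nF; exists F.
  by apply: le_trans (ltW lt); rewrite ler_wpM2r// ge_min lexx.
have np : 0 < n2 h.
  rewrite lt_neqAle n0 andbT eq_sym; apply/negP => /eqP h0.
  by apply: nF; exists fset0; rewrite h0 mulr0 sumr_ge0// => *; exact: sqmod_ge0.
have /andP[lb _] := hAB h; rewrite L2norm_sqr in lb.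
suff : ((A * n2 h)%:E <= (A / 2 * n2 h)%:E)%E.
  by rewrite lee_fin ler_pM2r//; lra.
apply: (le_trans lb); apply: ge_ereal_sup => _ [X [finX _] <-].
have [F ->] := finite_fsetP.1 finX.
by rewrite fsbig_fset lee_fin.
Qed.

End frame_bounds.

Section gabor_orbit.
Variable R : realType.
Local Notation L2 := (L2 R).
Local Notation n2 := (sqn (@inner R)).
Variables (g : L2) (a b : R).
Local Notation f := (gabor g a b).
Implicit Types (h u v : L2) (w : int * int).
Let HI := semi_inner_inner R.

Definition time_frequency_shift w h : L2 :=
  modulation (w.1%:~R * b) (translation (w.2%:~R * a) h).
Local Notation L := time_frequency_shift.

Lemma tf_shift_linear w : linear (L w).
Proof.
by move=> z u v; rewrite /L translation_linear modulation_linear.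
Qed.

Lemma tf_shift_norm w h : n2 (L w h) = n2 h.
Proof. by rewrite modulation_norm translation_norm. Qed.

Lemma gabor_shift w : f w = L w g.
Proof. exact: gaborE. Qed.

Lemma gabor0 : f 0 = g.
Proof. by rewrite gaborE /= !mul0r translation0 modulation0. Qed.

(** The factor comes from the commutation of translations with modulations. *)
Lemma tf_shift_gabor w : exists2 z : int * int -> R[i],
  forall v : int * int, sqmod (z v) = 1 & forall v : int * int, L w (f v) = z v *: f (v + w).
Proof.
exists (fun v : int * int => cis (- (2 * pi * (v.1%:~R * b) * (w.2%:~R * a)))).
  by move=> v; rewrite sqmod_cis.
move=> v; rewrite !gaborE /L translation_modulation (linZ (modulation_linear _)).
rewrite modulationD translationD -!mulrDl -!intrD.
by congr (_ *: modulation (_%:~R * b) (translation (_%:~R * a) g)); rewrite addrC.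
Qed.

(** The inverse of [time_frequency_shift a b w]. *)
Definition tf_unshift w h : L2 :=
  translation (- (w.2%:~R * a)) (modulation (- (w.1%:~R * b)) h).

Lemma tf_unshiftK w h : L w (tf_unshift w h) = h.
Proof.
by rewrite /L /tf_unshift translationD subrr translation0 modulationD subrr modulation0.
Qed.

Lemma opzS (T : L2 -> L2) (k : int) u : bijective T -> opz T (k + 1) u = T (opz T k u).
Proof.
move=> bT; have [TK KT] := pinv_bijK bT.
case: k => n; first by rewrite -[Posz n + 1]/(Posz (n + 1)) addn1.
case: n => [|n]; first by rewrite -[Negz 0 + 1]/(Posz 0) /= KT.
have -> : Negz n.+1 + 1 = Negz n by lia.
by rewrite -[opz T (Negz n.+1) u]/(iter n.+2 _ u) iterS KT.
Qed.

End gabor_orbit.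

(** * The density of a Gabor Riesz basis *)

Section density_identity.
Variable R : realType.
Local Notation mu := (@lebesgue_measure R).
Local Notation L2 := (L2 R).
Local Notation l2fun := (l2fun R).
Local Notation pi2 := (\pi_L2%qT : l2fun -> L2).
Local Notation n2 := (sqn (@inner R)).
Implicit Types (h u v : L2).
Let HI := semi_inner_inner R.

Lemma sqn_distC u v : n2 (u - v) = n2 (v - u).
Proof. by rewrite -(sqnN HI) opprB. Qed.

Section interval_functions.
Variable e : R.
Local Notation I c := (`[c, c + e[%classic : set R).

Lemma measurable_interval c : measurable (I c). Proof. exact: measurable_itv. Qed.
Lemma interval_lty c : (mu (I c) < +oo)%E.
Proof. by rewrite lebesgue_measure_itv /= -EFinB; case: ifP => _; rewrite ltry. Qed.
Local Notation mI := measurable_interval.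

Definition box c : L2 := indicL2 (mI c) (interval_lty c).

Lemma translation_box t c : translation t (box c) = box (c + t).
Proof.
rewrite /box /indicL2 pi_translation; congr (pi2 _); apply: val_inj; apply/funext => x.
rewrite -[LHS]/((\1_(I c) (x - t))%:C%C) -[RHS]/((\1_(I (c + t)) x)%:C%C).
rewrite !indicE; congr ((nat_of_bool _)%:R)%:C%C.
apply/idP/idP => /set_mem; rewrite /= in_itv /= => /andP[h1 h2]; apply: mem_set;
  by rewrite /= in_itv /=; apply/andP; split; lra.
Qed.

Lemma norm_box c : 0 < e -> n2 (box c) = e.
Proof.
move=> e0; rewrite indicL2_norm lebesgue_measure_itv /= lte_fin ltrDl e0 /=.
by rewrite addrAC subrr add0r.
Qed.

Lemma cut_cut (A D : set R) (mA : measurable A) (mD : measurable D) u : A `<=` D ->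
  cut mA (cut mD u) = cut mA u.
Proof.
move=> AD; elim/L2_ind: u => h; rewrite !pi_cut; congr (pi2 _); apply: val_inj.
apply/funext => x.
rewrite -[LHS]/((\1_A x)%:C%C * ((\1_D x)%:C%C * h x)) -[RHS]/((\1_A x)%:C%C * h x).
rewrite !indicE; case: (boolP (x \in A)) => [xA|_]; last by rewrite !mul0r.
by rewrite (mem_set (AD _ (set_mem xA))) [X in _ * X]mul1r.
Qed.

End interval_functions.

Lemma cut_ext (A D : set R) (mA : measurable A) (mD : measurable D) u : A = D ->
  cut mA u = cut mD u.
Proof.
by move=> AD; elim/L2_ind: u => h; rewrite !pi_cut; congr (pi2 _); apply: val_inj; rewrite /= AD.
Qed.

Lemma cut_interval_add (d e x : R) u : 0 <= d -> 0 <= e ->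
  cut (measurable_interval (d + e) x) u =
  cut (measurable_interval d x) u + cut (measurable_interval e (x + d)) u.
Proof.
move=> d0 e0; elim/L2_ind: u => h; rewrite !pi_cut -pi_L2D; congr (pi2 _); apply: val_inj.
apply/funext => y; set A := `[x, x + (d + e)[%classic.
set A1 := `[x, x + d[%classic; set A2 := `[x + d, x + d + e[%classic.
rewrite -[LHS]/((\1_A y)%:C%C * h y).
rewrite -[RHS]/((\1_A1 y)%:C%C * h y + (\1_A2 y)%:C%C * h y) -mulrDl -rmorphD.
have itv (p q : R) : (\1_(`[p, q[%classic) y : R) = (p <= y < q)%R%:R.
  rewrite indicE; congr ((nat_of_bool _)%:R).
  by apply/idP/idP => [/set_mem|yp]; [|apply: mem_set]; rewrite /= in_itv.
suff -> : (\1_A y : R) = \1_A1 y + \1_A2 y by [].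
rewrite !itv addrA.
have [xy|xy] /= := leP x y; have [ye|ye] /= := ltP y (x + d + e);
  have [yd|yd] /= := leP (x + d) y; rewrite ?addr0 ?add0r//; lra.
Qed.

Lemma cut_interval_chain (d x : R) (m : nat) u : 0 <= d ->
  \sum_(k < m) cut (measurable_interval d (x + k%:R * d)) u =
  cut (measurable_interval (m%:R * d) x) u.
Proof.
move=> d0; elim: m => [|m IH].
  rewrite big_ord0; elim/L2_ind: u => h; rewrite pi_cut.
  rewrite -(scale0r (pi2 h)) -pi_L2Z; congr (pi2 _); apply: val_inj; apply/funext => y.
  rewrite -[LHS]/(0 * h y) -[RHS]/((\1_(`[x, x + 0%:R * d[%classic) y)%:C%C * h y).
  suff -> : (`[x, x + 0%:R * d[%classic : set R) = set0 by rewrite indicE in_set0 !mul0r.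
  by rewrite -[0%:R]/(0 : R) mul0r addr0 set_itvco0.
rewrite big_ord_recr /= IH -cut_interval_add ?mulr_ge0//.
by apply: cut_ext; rewrite -natr1 mulrDl mul1r.
Qed.

Lemma cut_exhausts (a : R) u eta : 0 < a -> 0 < eta -> exists K0 : nat, forall K, (K0 <= K)%N ->
  n2 (u - cut (measurable_interval (K.*2.+1%:R * a) (- (K%:R * a))) u) <= eta.
Proof.
move=> a0 eta0; elim/L2_ind: u => h.
pose A (K : nat) := `[- (K%:R * a), - (K%:R * a) + K.*2.+1%:R * a[%classic : set R.
pose r K : l2fun := h + (-1) *: l2cut (measurable_interval (K.*2.+1%:R * a) (- (K%:R * a))) h.
have rE K x : r K x = (1 - \1_(A K) x)%:C%C * h x.
  rewrite -[LHS]/(h x + -1 * ((\1_(A K) x)%:C%C * h x)) rmorphB rmorph1; ring.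
have [||K0 hK] := @sqn_dominated R r h _ _ _ eta0.
- by move=> K x; rewrite rE sqmodM sqmodR ler_piMl ?sqmod_ge0.
- apply: aeW => x; apply: cvg_near_cst; exists (Num.truncn (`|x| / a)).+1 => // K xK.
  rewrite rE indicE mem_set ?subrr ?mul0r ?sqmod0// /A /= in_itv /=.
  have xa : `|x| < K%:R * a.
    rewrite -ltr_pdivrMr//; apply: (lt_le_trans (truncnS_gt _)).
    by rewrite ler_nat; exact: xK.
  have /andP[h1 h2] : - (K%:R * a) < x < K%:R * a by rewrite -ltr_norml.
  rewrite ltW//= -natr1 -addnn natrD; lra.
exists K0 => K KK; have := hK K KK.
by rewrite /r pi_L2D pi_L2Z scaleN1r pi_cut.
Qed.

(** [P] stands for the dual form of the frame and [c0] for the energy of [g]. *)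
Section recover_density.
Variables (g : L2) (a b : R) (a_gt0 : 0 < a) (b_gt0 : 0 < b).
Local Notation f := (gabor g a b).
Variable P : L2 -> L2 -> R[i].
Hypothesis HP : semi_inner P.
Hypothesis P_shift : forall w h, P (time_frequency_shift a b w h) (f w) = P h g.
Variables (C c0 : R).
Hypothesis P_bounded : forall h, sqmod (P h g) <= C * n2 h.
Hypothesis P_gg : P g g = c0%:C%C.
Hypothesis recon : forall h eta, 0 < eta -> exists F, forall G, (F `<=` G)%fset ->
  n2 (synthesis f G (fun w => P h (f w)) - c0%:C%C *: h) <= eta.

Let phi h : R := Re (P h g).

Let phiB u v : phi (u - v) = phi u - phi v.
Proof. by rewrite /phi (siBl HP) !complex_parts. Qed.

Let phi_small eta : 0 < eta -> exists2 d, 0 < d & forall h, n2 h <= d -> `|phi h| <= eta.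
Proof.
move=> eta0; pose K := `|C| + 1; have K0 : 0 < K by rewrite /K; have := normr_ge0 C; lra.
exists (eta ^+ 2 / K); first by rewrite divr_gt0// exprn_gt0.
move=> h hd; apply: Re_le_sqmod; first exact: ltW.
apply: (le_trans (P_bounded h)).
apply: (@le_trans _ _ (K * n2 h)).
  by rewrite ler_wpM2r ?(sqn_ge0 HI)// /K; have := ler_norm C; lra.
by rewrite mulrC -ler_pdivlMr.
Qed.

Section one_interval.
Variables (s0 e : R) (e_gt0 : 0 < e) (eb : e <= b^-1).
Local Notation I c := (`[c, c + e[%classic : set R).
Local Notation J c := (`[c, c + b^-1[%classic : set R).
Local Notation mI c := (measurable_interval e c).
Let v := box e s0.
Let start (n : int) : R := s0 - n%:~R * a.
Let cutI (n : int) : L2 -> L2 := cut (mI (start n)).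
Local Notation wv n := (wave (start n) b_gt0).

Let I_J c : I c `<=` J c.
Proof.
move=> x; rewrite /= !in_itv /= => /andP[-> h2] /=.
by apply: lt_le_trans h2 _; rewrite lerD2l.
Qed.

Let mJ c : measurable (J c). Proof. exact: measurable_itv. Qed.

Let box_cut t n : modulation t (box e (start n)) =
  cutI n (modulation t (period_one (start n) b_gt0)).
Proof.
rewrite /cutI cut_modulation; congr modulation; rewrite /box /period_one /indicL2 pi_cut.
congr (pi2 _); apply: val_inj; apply/funext => x.
rewrite -[LHS]/((\1_(I (start n)) x)%:C%C).
rewrite -[RHS]/((\1_(I (start n)) x)%:C%C * (\1_(J (start n)) x)%:C%C).
rewrite !indicE; case: (boolP (x \in I (start n))) => [xI|_]; last by rewrite mul0r.
by rewrite (mem_set (I_J (set_mem xI))) mul1r.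
Qed.

(** The shift of index [(m, n)] is moved from the frame element to [v].  The phase
    from the commutation relation occurs once with its conjugate and
    disappears, and what remains of [v] is a wave restricted to an interval. *)
Let term m n : P v (f (m, n)) * inner (f (m, n)) v =
  P (inner (cutI n g) (wv n (- m)) *: cutI n (wv n (- m))) g.
Proof.
set Y := cutI n (wv n (- m)); set X := tf_unshift a b (m, n) v.
pose z : R[i] := cis (- (2 * pi * (- (m%:~R * b)) * (- (n%:~R * a)))).
have XE : X = z *: Y.
  rewrite /X /tf_unshift translation_modulation translation_box -[s0 + _]/(start n).
  by rewrite box_cut /Y /wave mulrNz mulNr.
have vX : v = time_frequency_shift a b (m, n) X by rewrite tf_unshiftK.
have -> : P v (f (m, n)) = P X g by rewrite {1}vX P_shift.
have -> : inner (f (m, n)) v = inner g X.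
  rewrite {1}vX gabor_shift; apply: (isometry_inner (tf_shift_linear _ _ _) HI).
  exact: tf_shift_norm.
have zz : z * z^*%C = 1 by rewrite mulcJ sqmod_cis.
rewrite XE (siZl HP) (siZr HI) (siZl HP).
by rewrite mulrACA zz mul1r mulrC /cutI cut_self_adjoint.
Qed.

(** Summing over [m] produces the Fourier sum of [g] restricted to the interval. *)
Let term_sum M n : \sum_(m <- frequencies M) P v (f (m, n)) * inner (f (m, n)) v =
  (b^-1)%:C%C * P (cutI n (fourier_sum (start n) b_gt0 M (cutI n g))) g.
Proof.
under eq_bigr do rewrite term.
rewrite -(si_suml HP) (sum_frequencies_opp M (fun m => inner (cutI n g) (wv n m) *: cutI n (wv n m))).
rewrite -(siZl HP); congr (P _ g).
rewrite /fourier_sum [in RHS]/cutI (lin_sum (cut_linear _)) scaler_sumr; apply: eq_bigr => m _.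
rewrite [RHS](_ : _ = (b^-1)%:C%C *: ((b%:C%C * inner (cutI n g) (wv n m)) *: cutI n (wv n m))).
  by rewrite scalerA mulrA -rmorphM mulVf ?gt_eqF// rmorph1 mul1r.
by congr (_ *: _); exact: (linZ (cut_linear _)).
Qed.

Let rowsum M n : R := Re (\sum_(m <- frequencies M) P v (f (m, n)) * inner (f (m, n)) v).

Let row_limit n eta : 0 < eta -> exists M0 : nat, forall M, (M0 <= M)%N ->
  `|rowsum M n - b^-1 * phi (cutI n g)| <= eta.
Proof.
move=> eta0; have be : 0 < b * eta by rewrite mulr_gt0.
have [d d0 hd] := phi_small be.
have [M0 hM] := fourier_expansion b_gt0 (mJ (start n)) (cutI n g) d0.
exists M0 => M MM; rewrite /rowsum term_sum.
have -> : Re ((b^-1)%:C%C * P (cutI n (fourier_sum (start n) b_gt0 M (cutI n g))) g) =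
    b^-1 * phi (cutI n (fourier_sum (start n) b_gt0 M (cutI n g))).
  by rewrite Re_mul ReR ImR mul0r subr0.
rewrite -mulrBr normrM ger0_norm ?invr_ge0 ?(ltW b_gt0)//.
rewrite mulrC ler_pdivrMr// mulrC -phiB; apply: hd.
(* the Fourier expansion lives on the interval of length [1 / b] *)
have cutE : cutI n g = cutI n (cut (mJ (start n)) (cutI n g)).
  rewrite /cutI (cut_cut _ _ _ (@I_J (start n))).
  by rewrite (cut_cut _ _ _ (@subset_refl _ (I (start n)))).
rewrite [X in _ - X]cutE -(linB (cut_linear _)).
apply: (le_trans (cut_norm _ _)).
by rewrite sqn_distC; exact: hM.
Qed.

Let rows_limit (r : seq int) eta : 0 < eta -> exists M0 : nat, forall M, (M0 <= M)%N ->
  `|\sum_(n <- r) rowsum M n - b^-1 * \sum_(n <- r) phi (cutI n g)| <= eta.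
Proof.
elim: r eta => [|n r IH] eta eta0.
  by exists 0%N => M _; rewrite !big_nil mulr0 subrr normr0 ltW.
have e2 : 0 < eta / 2 by rewrite divr_gt0.
have [M1 h1] := IH _ e2; have [M2 h2] := row_limit n e2.
exists (maxn M1 M2) => M; rewrite geq_max => /andP[/h1{}h1 /h2{}h2].
rewrite !big_cons mulrDr opprD addrACA; apply: (le_trans (ler_normD _ _)).
by rewrite [leRHS](splitr eta) lerD.
Qed.

Let lattice_box M K : {fset int * int} :=
  [fset w in [seq (m, n) | n <- frequencies K, m <- frequencies M]]%fset.

Let sum_lattice_box M K (F : int * int -> R[i]) :
  \sum_(w <- lattice_box M K) F w =
  \sum_(n <- frequencies K) \sum_(m <- frequencies M) F (m, n).
Proof.
transitivity (\sum_(w <- [seq (m, n) | n <- frequencies K, m <- frequencies M]) F w);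
  last by rewrite big_allpairs_dep.
apply: perm_big; apply: uniq_perm.
- exact: fset_uniq.
- apply: allpairs_uniq; [exact: frequencies_uniq|exact: frequencies_uniq|].
  by move=> [n m] [n' m'] _ _ /= [-> ->].
- by move=> w; rewrite /lattice_box in_fset.
Qed.

Let lattice_box_exhausts (F : {fset int * int}) : exists K0 : nat, forall M K,
  (K0 <= M)%N -> (K0 <= K)%N -> (F `<=` lattice_box M K)%fset.
Proof.
exists (\sum_(w <- F) (`|w.1| + `|w.2|))%N => M K hM hK.
apply/fsubsetP => w wF.
have hw : (`|w.1| + `|w.2| <= \sum_(u <- F) (`|u.1| + `|u.2|))%N.
  by rewrite (big_rem w)//= leq_addr.
rewrite /lattice_box in_fset; apply/allpairsP; exists (w.2, w.1) => /=; split.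
- rewrite mem_frequencies -abszE lez_nat; apply: leq_trans hK; apply: leq_trans hw.
  exact: leq_addl.
- rewrite mem_frequencies -abszE lez_nat; apply: leq_trans hM; apply: leq_trans hw.
  exact: leq_addr.
- by case: (w).
Qed.

(** Pair the reconstruction of [v] with [v], whose squared norm is [e], over a
    box of indices: the number [K] of translations is fixed first, then the
    number [M] of modulations is taken large enough for the Fourier sums. *)
Lemma interval_limit eta : 0 < eta -> exists K0 : nat, forall K, (K0 <= K)%N ->
  `|b^-1 * \sum_(n <- frequencies K) phi (cut (mI (s0 - n%:~R * a)) g) - c0 * e| <= eta.
Proof.
move=> eta0; have e2 : 0 < eta / 2 by rewrite divr_gt0.
have d0 : 0 < (eta / 2) ^+ 2 / e by rewrite divr_gt0// exprn_gt0.
have [F hF] := recon v d0; have [K0 hK0] := lattice_box_exhausts F.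
exists K0 => K KK; have [M1 hM1] := rows_limit (frequencies K) e2.
pose M := maxn M1 K0.
have MM : (M1 <= M)%N by rewrite leq_maxl.
have KM : (K0 <= M)%N by rewrite leq_maxr.
have h1 := hF _ (hK0 _ _ KM KK); have h2 := hM1 _ MM.
set S := synthesis f _ _ in h1.
have h3 : `|Re (inner (S - c0%:C%C *: v) v)| <= eta / 2.
  apply: Re_le_sqmod; first exact: ltW.
  apply: (le_trans (cauchy_schwarz HI _ _)); rewrite norm_box//.
  by rewrite -ler_pdivlMr.
have h4 : Re (inner (S - c0%:C%C *: v) v) =
    \sum_(n <- frequencies K) rowsum M n - c0 * e.
  have e1 : Re (c0%:C%C * e%:C%C) = c0 * e by rewrite /= mulr0 subr0.
  rewrite (siBl HI) ReD ReN (siZl HI) (si_uu HI) norm_box// e1.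
  suff -> : Re (inner S v) = \sum_(n <- frequencies K) rowsum M n by [].
  rewrite /S /synthesis (si_suml HI) sum_lattice_box Re_sum; apply: eq_bigr => n _.
  by rewrite /rowsum; congr (complex.Re _); apply: eq_bigr => m _; rewrite (siZl HI).
rewrite h4 in h3; move: h2 h3; rewrite -/(cutI _).
set X := \sum_(n <- _) rowsum M n.
rewrite (_ : \sum_(n <- _) phi (cut _ g) = \sum_(n <- frequencies K) phi (cutI n g))//.
by rewrite !ler_norml => /andP[? ?] /andP[? ?]; apply/andP; split; lra.
Qed.

End one_interval.

Let phi_sum (I : Type) (r : seq I) (F : I -> L2) :
  phi (\sum_(i <- r) F i) = \sum_(i <- r) phi (F i).
Proof. by rewrite /phi (si_suml HP) Re_sum. Qed.

Let intervals_limit e (m : nat) eta : 0 < e -> e <= b^-1 -> 0 < eta ->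
  exists K0 : nat, forall K, (K0 <= K)%N ->
  `|b^-1 * \sum_(j < m) \sum_(n <- frequencies K)
      phi (cut (measurable_interval e (j%:R * e - n%:~R * a)) g) - m%:R * (c0 * e)| <= eta.
Proof.
move=> e0 eb; elim: m eta => [|m IH] eta eta0.
  by exists 0%N => K _; rewrite big_ord0 mulr0 mul0r subrr normr0 ltW.
have e2 : 0 < eta / 2 by rewrite divr_gt0.
have [K1 h1] := IH _ e2; have [K2 h2] := interval_limit (m%:R * e) e0 eb e2.
exists (maxn K1 K2) => K; rewrite geq_max => /andP[/h1{}h1 /h2{}h2].
rewrite big_ord_recr /= mulrDr -natr1 mulrDl mul1r opprD addrACA.
by apply: (le_trans (ler_normD _ _)); rewrite [leRHS](splitr eta) lerD.
Qed.

(** The translates of the [N] intervals tile a long interval centred near zero. *)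
Let intervals_sum (N K : nat) : (0 < N)%N ->
  \sum_(j < N) \sum_(n <- frequencies K)
    phi (cut (measurable_interval (a / N%:R) (j%:R * (a / N%:R) - n%:~R * a)) g) =
  phi (cut (measurable_interval (K.*2.+1%:R * a) (- (K%:R * a))) g).
Proof.
move=> N0; have N0' : (0 : R) < N%:R by rewrite ltr0n.
have e0 : 0 <= a / N%:R by rewrite divr_ge0 ?ltW.
rewrite exchange_big /= -(cut_interval_chain _ _ _ (ltW a_gt0)) phi_sum.
rewrite -(sum_frequencies_opp K) /frequencies big_map -[X in iota 0 X]subn0 -/(index_iota 0 _) big_mkord.
apply: eq_bigr => k _; rewrite -phi_sum.
have -> : - (K%:R * a) + k%:R * a = - ((- (k%:Z - K%:Z))%:~R * a).
  by rewrite mulrNz mulNr opprK intrB; ring.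
set x := - (_ * a).
have NaN : N%:R * (a / N%:R) = a by rewrite mulrCA mulfV ?mulr1// gt_eqF.
rewrite -[RHS](congr1 phi (cut_ext (measurable_interval (N%:R * (a / N%:R)) x) _ g _)); last first.
  by rewrite NaN.
rewrite -(cut_interval_chain _ _ _ e0); congr phi; apply: eq_bigr => j _.
by apply: cut_ext; rewrite /x [_ - _]addrC.
Qed.

(** Tile a period of length [a] by [N] intervals no longer than [1 / b], so that
    [interval_limit] applies to each of them: the total is [c0 * a] on one side and
    [P g g / b = c0 / b] on the other. *)
Lemma lattice_density : c0 != 0 -> a * b = 1.
Proof.
move=> c00.
pose N := (Num.truncn (a * b)).+1.
have N0 : (0 : R) < N%:R by rewrite ltr0n.
have NE : N%:R != 0 :> R by rewrite gt_eqF.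
pose e := a / N%:R.
have e0 : 0 < e by rewrite divr_gt0.
have eb : e <= b^-1.
  by rewrite -[b^-1]mul1r ler_pdivlMr// mulrAC ler_pdivrMr// mul1r ltW// truncnS_gt.
have phi_g : phi g = c0 by rewrite /phi P_gg.
have small eta : 0 < eta -> `|b^-1 * c0 - c0 * a| <= eta.
  move=> eta0; have e2 : 0 < eta / 2 by rewrite divr_gt0.
  have be : 0 < b * (eta / 2) by rewrite mulr_gt0.
  have [K1 h1] := intervals_limit N e0 eb e2.
  have [d d0 hd] := phi_small be.
  have [K2 h2] := cut_exhausts g a_gt0 d0.
  pose K := maxn K1 K2.
  have {h1} := h1 K (leq_maxl _ _); have {h2}/hd := h2 K (leq_maxr _ _).
  rewrite intervals_sum// phiB phi_g; set y := phi _ => h2 h1.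
  have Ne : N%:R * (c0 * e) = c0 * a by rewrite mulrCA; congr (_ * _); rewrite /e mulrCA mulfV// mulr1.
  have h3 : `|b^-1 * c0 - b^-1 * y| <= eta / 2.
    by rewrite -mulrBr normrM ger0_norm ?invr_ge0 ?(ltW b_gt0)// mulrC ler_pdivrMr// mulrC.
  rewrite Ne in h1; move: h1 h3.
  by rewrite !ler_norml => /andP[? ?] /andP[? ?]; apply/andP; split; lra.
have : `|b^-1 * c0 - c0 * a| <= 0.
  by apply/ler_addgt0Pr => eta eta0; rewrite add0r small.
rewrite normr_le0 subr_eq0 mulrC => /eqP/(mulfI c00) <-.
by rewrite mulVf// gt_eqF.
Qed.

End recover_density.
End density_identity.

Lemma irrational_neq1 (R : realType) (x : R) : irrational x -> x <> 1.
Proof. by move=> irr x1; apply: irr; rewrite x1; apply/rationalP; exists 1, 1%N; rewrite divr1. Qed.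

Theorem theorem3p6 (R : realType) (g : L2 R) (a b : R)
    (a_gt0 : 0 < a) (b_gt0 : 0 < b)
    (frame_g : is_frame (gabor g a b)) (irr_ab : irrational (a * b))
    (sigma : int -> int * int) (sigma_bij : bijective sigma) :
  ~ exists T : L2 R -> L2 R, is_GL T /\
      forall k : int, gabor g a b (sigma k) = opz T k (gabor g a b (sigma 0)).
Proof.
move=> [T [[T_lin [M T_bdd] T_bij] orbit]].
have [A [B [A_gt0 AB bessel lower]]] := frame_finite_sums frame_g.
have HI := semi_inner_inner R.
set f := gabor g a b in bessel lower orbit *.
have T_f k : T (f (sigma k)) = f (sigma (k + 1)).
  by rewrite [RHS]orbit opzS// -orbit.
have M_gt0 : 0 < M ^+ 2 + 1 by have := sqr_ge0 M; lra.
(* [M] may be negative or zero; its square plus one is a positive bound *)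
have T_norm h : sqn (@inner R) (T h) <= (M ^+ 2 + 1) * sqn (@inner R) h.
  have h0 : 0 <= L2norm (T h) by exact: sqrtr_ge0.
  rewrite -!L2norm_sqr; apply: (@le_trans _ _ ((M * L2norm h) ^+ 2)).
    by have := T_bdd h; rewrite !expr2 => le; apply: ler_pM.
  by rewrite exprMn ler_wpM2r ?sqr_ge0// lerDl.
have L_f := tf_shift_gabor g a b.
have diag := dual_form_diagonal HI A_gt0 AB bessel lower (@tf_shift_linear R a b)
  (@tf_shift_norm R a b) L_f sigma_bij T_lin M_gt0 T_norm T_f.
have orbitQ := dual_energy_orbit HI A_gt0 AB bessel lower (@tf_shift_linear R a b)
  (@tf_shift_norm R a b) L_f.
have HP := semi_inner_dual_form HI A_gt0 AB bessel lower.
have f0 : f 0 = g by exact: gabor0.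
have fE w : f w = time_frequency_shift a b w g by exact: gabor_shift.
(* [f w] is the image of [g] by the shift of index [w] *)
have P_shift w h : dual_form (@inner R) f (time_frequency_shift a b w h) (f w) =
    dual_form (@inner R) f h g.
  have := dual_form_lattice HI A_gt0 AB bessel lower (@tf_shift_linear R a b)
    (@tf_shift_norm R a b) L_f w 0 h.
  by rewrite f0 -fE.
have [C C0 hC] := dual_energy_bound HI A_gt0 AB bessel lower.
set Q := dual_energy (@inner R) f in hC orbitQ.
have Qf w : Q (f w) = Q g by rewrite orbitQ f0.
have sqnP h : sqn (dual_form (@inner R) f) h = Q h.
  exact: (sqn_dual_form HI A_gt0 AB bessel lower).
have P_bounded h : sqmod (dual_form (@inner R) f h g) <= C * Q g * sqn (@inner R) h.
  apply: (le_trans (cauchy_schwarz HP h g)); rewrite !sqnP mulrAC.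
  by rewrite ler_wpM2r// -sqnP (sqn_ge0 HP).
have P_gg : dual_form (@inner R) f g g = (Q g)%:C%C.
  by rewrite (si_uu HP) sqnP.
have recon h eta : 0 < eta -> exists F : {fset int * int}, forall G, (F `<=` G)%fset ->
    sqn (@inner R) (synthesis f G (fun w => dual_form (@inner R) f h (f w)) - (Q g)%:C%C *: h) <= eta.
  exact: (reconstruction HI A_gt0 AB bessel lower diag Qf).
(* a vanishing [g] would contradict the lower frame bound *)
have Qg : Q g != 0.
  apply/negP => /eqP Qg0.
  have := norm_le_dual_energy HI A_gt0 AB bessel lower g.
  rewrite -/Q Qg0 mulr0 => g0.
  pose h := box 1 (0 : R).
  have [F] := lower h; rewrite norm_box// mulr1 leNgt => /negP; apply.
  rewrite big1 // => w _; apply/eqP; rewrite eq_le sqmod_ge0 andbT.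
  apply: (le_trans (cauchy_schwarz HI _ _)).
  rewrite fE tf_shift_norm norm_box// mul1r.
  exact: g0.
apply: (irrational_neq1 irr_ab).
exact: (lattice_density a_gt0 b_gt0 HP P_shift P_bounded P_gg recon Qg).
Qed.
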